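(* For every prime power $q>2$, $$\delta^{\mathrm{rk}}_3(4,4,2;q)=\frac12\cdot\frac{q^7(q^3-1)(q^2-1)(q-1)(q^3-q^2-q-1)(q^8-1)(q^4-1)}{(q^{16}-1)(q^{12}-1)}.$$ In particular, $$\lim_{q\to\infty}\delta^{\mathrm{rk}}_3(4,4,2;q)=\frac12,$$ the limit being taken over prime powers $q$.
   Context: Let $q$ be a prime power. The rank $\mathrm{rk}(v)$ of $v\in\mathbb{F}_{q^m}^n$ is the dimension over $\mathbb{F}_q$ of the $\mathbb{F}_q$-span of its entries. For a nonzero $\mathbb{F}_{q^m}$-linear subspace $\mathcal{C}\le\mathbb{F}_{q^m}^n$ (a rank-metric code), its minimum distance is $d^{\mathrm{rk}}(\mathcal{C})=\min\{\mathrm{rk}(v): v\in\mathcal{C},\ v\ne 0\}$. The density function is $$\delta^{\mathrm{rk}}_d(m,n,k;q)=\frac{|\{\mathcal{C}\le\mathbb{F}_{q^m}^n : \mathcal{C}\ \mathbb{F}_{q^m}\text{-linear},\ \dim_{\mathbb{F}_{q^m}}(\mathcal{C})=k,\ d^{\mathrm{rk}}(\mathcal{C})\ge d\}|}{\begin{bmatrix}n\\k\end{bmatrix}_{q^m}},$$ where $\begin{bmatrix}n\\k\end{bmatrix}_{q^m}$ is the Gaussian binomial coefficient, i.e. the number of $k$-dimensional $\mathbb{F}_{q^m}$-subspaces of $\mathbb{F}_{q^m}^n$. *)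

(* Defs.v *)
From HB Require Import structures.
From mathcomp Require Import all_boot all_order all_fingroup all_algebra all_field.
From mathcomp Require Import boolp classical_sets filter reals topology normedtype.
Import GRing.Theory.

Set Implicit Arguments.
Unset Strict Implicit.
Unset Printing Implicit Defensive.

Local Open Scope ring_scope.

(* The library equips {vspace vT} with a choiceType structure only; over a     *)
(* finite field it is a finType, which lets one count subspaces.               *)
Section FiniteSubspaces.
Import VectorInternalTheory.
Variables (K : finFieldType) (vT : vectType K).

HB.instance Definition _ := [Countable of {vspace vT} by <:].
HB.instance Definition _ := [Finite of {vspace vT} by <:].

End FiniteSubspaces.

Definition prime_power (q : nat) : Prop :=
  exists p e : nat, [/\ prime p, (0 < e)%N & q = (p ^ e)%N].

(* Counts subspaces; [n choose k]_Q depends on K only through Q = #|K|.        *)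
Definition gauss_binom (K : finFieldType) (n k : nat) : nat :=
  #|[set C : {vspace 'rV[K]_n} | \dim C == k]|.

(* F plays the role of F_q and L that of F_(q^m), with m = \dim {:L}.  The     *)
(* alias finvect_type L is L itself, carrying both its finFieldType and its    *)
(* fieldExtType F structure.                                                   *)
Section RankMetric.
Variables (F : finFieldType) (L : fieldExtType F) (n : nat).
Local Notation fL := (finvect_type L).

(* \dim and <<_>> are taken over F.                                            *)
Definition rk (v : 'rV[fL]_n) : nat :=
  \dim <<[seq v ord0 j | j : 'I_n]>>%VS.

(* Since rk v <= n, the default value n does not affect the minimum when       *)
(* C != 0 (see rk_distP); the zero code gets the junk value n.                 *)
Definition rk_dist (C : {vspace 'rV[fL]_n}) : nat :=
  \big[minn/n]_(v in C | v != 0) rk v.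

Lemma rk_le_n (v : 'rV[fL]_n) : (rk v <= n)%N.
Proof. by rewrite (leq_trans (dim_span _)) // size_image card_ord. Qed.

Lemma rk_distP (C : {vspace 'rV[fL]_n}) : C != 0%VS ->
  (exists v, [/\ v \in C, v != 0 & rk v = rk_dist C]) /\
  (forall v, v \in C -> v != 0 -> (rk_dist C <= rk v)%N).
Proof.
move=> C0; have le v : v \in C -> v != 0 -> (rk_dist C <= rk v)%N.
  move=> vC v0; rewrite /rk_dist.
  elim: (index_enum _) (mem_index_enum v) => //= w s IHs.
  rewrite inE big_cons => /predU1P[<-|/IHs le_s]; first by rewrite vC v0 geq_minl.
  by case: ifP => // _; apply: leq_trans le_s; apply: geq_minr.
split=> //; have vC := memv_pick C; rewrite -vpick0 in C0.
have: rk_dist C = n \/ exists v, [/\ v \in C, v != 0 & rk v = rk_dist C].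
  rewrite /rk_dist; elim/big_ind: _ => [|x y hx hy|v /andP[? ?]].
  - by left.
  - by rewrite /minn; case: ifP.
  - by right; exists v.
case=> // dn; exists (vpick C); split=> //.
by apply/eqP; rewrite eqn_leq le // dn rk_le_n.
Qed.

End RankMetric.

Definition rk_density (R : realType) (F : finFieldType) (L : fieldExtType F)
    (n k d : nat) : R :=
  #|[set C : {vspace 'rV[finvect_type L]_n}
      | (\dim C == k) && (d <= rk_dist C)%N]|%:R
  / (gauss_binom (finvect_type L) n k)%:R.

(* F_q and F_(q^m) exist, so quantifying over all models of them is not        *)
(* vacuous.                                                                    *)
Lemma finite_field_ext_exists (q m : nat) : prime_power q -> (0 < m)%N ->
  exists (F : finFieldType) (L : fieldExtType F), #|F| = q /\ \dim {:L} = m.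
Proof.
case=> p [e [p_pr e0 qE]] m0; have [F pF cF] := pPrimePowerField p_pr e0.
rewrite -qE in cF; exists F; have q1 : (1 < q)%N by rewrite -cF finNzRing_gt1.
pose M := (q ^ m)%N.
have M1 : (1 < M)%N by rewrite (ltn_exp2l 0).
have M0 := ltnW M1; have M10 : (0 < M.-1)%N by rewrite -ltnS prednK.
pose P := 'X^M - 'X.
have DP R : P R = ('X^(M.-1) - 1) * ('X - 0).
  by rewrite subr0 mulrBl mul1r -exprSr prednK.
have /FinSplittingFieldFor[/= L splitL]: P F != 0.
  by rewrite DP monic_neq0 ?rpredM ?monicXsubC ?monicXnsubC.
rewrite rmorphB rmorphXn /= map_polyX -/(P L) in splitL.
have pL : p \in [pchar L] by rewrite pchar_lalg.
pose Fm := FinFieldExtType L; exists L; split=> //.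
have /finField_galois_generator[/= a _ Da]: (1 <= {:L})%VS by apply: sub1v.
pose Em := fixedSpace (a ^+ m)%g; rewrite cF dimv1 expn1 in Da.
have [zs DqL defL] := splitL.
have Uzs: uniq zs.
  rewrite -separable_prod_XsubC -(eqp_separable DqL) DP separable_root andbC.
  rewrite /root !hornerE subr_eq0 eq_sym expr0n gtn_eqF ?oner_eq0 //=.
  rewrite cyclotomic.separable_Xn_sub_1 // -subn1 natrB // subr_eq0.
  by rewrite /M qE -expnM natrX pcharf0 // expr0n muln_eq0 !gtn_eqF // eq_sym oner_eq0.
have in_zs: zs =i Em.
  move=> z; rewrite -root_prod_XsubC -(eqp_root DqL) (sameP fixedSpaceP eqP).
  rewrite /root !hornerE subr_eq0 /= /M; congr (_ == z).
  elim: (m) => [|i IHi]; first by rewrite gal_id.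
  by rewrite expgSr expnSr exprM IHi galM ?Da ?memvf.
have defEm: Em = {:L}%VS.
  apply/eqP; rewrite eqEsubv subvf -defL -[Em]subfield_closed agenvS //.
  by rewrite subv_add sub1v; apply/span_subvP=> z; rewrite in_zs.
have cL : #|Fm| = M.
  have/eq_card->: Fm =i zs by move=> z; rewrite in_zs defEm memvf.
  apply: succn_inj; rewrite (card_uniqP _) //= -(size_prod_XsubC _ id).
  by rewrite -(eqp_size DqL) size_polyDl size_polyXn // size_polyN size_polyX.
have := @card_vspacef F Fm (Vector.on L); rewrite card_vspace cL cF.
by move=> /eqP; rewrite eqn_exp2l // => /eqP.
Qed.

(* Main.v *)
Require Import Defs.
From HB Require Import structures.
From mathcomp Require Import all_boot all_order all_fingroup all_algebra all_solvable all_field.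
From mathcomp Require Import ring zify.
Import GRing.Theory.

(* Put Q = q^4, let N be the norm from F_Q to F_q, and let powers of vectors  *)
(* be taken entrywise. The codes to be counted are the planes spanned by a    *)
(* vector u whose entries form an F_q-basis of F_Q and by                     *)
(* v = a u^q + b u^(q^3) with N(a) <> N(b). Each of them comes from exactly   *)
(* 2 (Q - 1)^2 triples (u, a, b), since u is unique up to scalars and up to   *)
(* exchanging the roles of u and v.                                           *)
(*   To find u in a code with basis g, h, note that the six 2 x 2 minors of   *)
(* (g; h) span an F_q-space of dimension at most 4, so two independent        *)
(* alternating forms w1, w2 over F_q vanish on (g, h). As no word of the code *)
(* has rank at most 2, all nonzero combinations of w1 and w2 over F_q are     *)
(* nondegenerate. The quadratic polynomial Pf(w1 - x w2) has a root x of      *)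
(* degree 2 over F_q, and the radical of w1 - x w2 meets the code in a vector *)
(* u; it also contains u^(q^2). The radical for the root x^q contains u^q and *)
(* u^(q^3), and it meets the code in v.                                       *)
(*   A word of rank at most 2 in the plane of (u, a, b) amounts to y, z in    *)
(* F_Q, independent over F_q, with a t = b t^(q^3) for t = y^q z - y z^q.     *)
(* Hence N(a) = N(b); the converse follows from Hilbert's Theorem 90 and the  *)
(* isotropy of binary Hermitian forms over F_(q^2).                           *)

(** The planes described above are exactly the codes to be counted: [mrd_exists] produces u, a, b
    for a given code, and [mrd_vtwist] and [norm_neq_of_mrd] show that N(a) <> N(b) is the exact
    condition on them. There are |GL_4(q)| choices of u ([card_rk4]) and (Q - 1) q (q^3 - q^2 - q -
    1) choices of (a, b) ([card_norm_neq]). By [card_fibre] the product is to be divided by 2 (Q -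
    1)^2, and [card_gauss_binom2] gives the number of all planes. The factor 1/2 of the density is
    thus the symmetry between u and v. What remains is a quotient of two monic polynomials in q,
    both of degree 28, so it tends to 1. *)

Set Implicit Arguments.
Unset Strict Implicit.
Unset Printing Implicit Defensive.

Local Open Scope ring_scope.

(** * The Frobenius map of a field of order q^4 *)

Section Fibres.
Variables (T S : finType) (A : {set T}) (B : {set S}) (f : T -> S) (k : nat).
Hypothesis fAB : forall x, x \in A -> f x \in B.

Lemma card_fibres_sum : #|A| = (\sum_(y in B) #|[set x in A | f x == y]|)%N.
Proof.
rewrite -sum1_card (partition_big f [in B]) //=.
by apply: eq_bigr => y _; rewrite -sum1_card; apply: eq_bigl => x; rewrite inE.
Qed.

Lemma card_fibres_eq :
  (forall y, y \in B -> #|[set x in A | f x == y]| = k) -> #|A| = (#|B| * k)%N.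
Proof. by move=> fk; rewrite card_fibres_sum (eq_bigr _ fk) sum_nat_const. Qed.

Lemma card_fibres_le :
  (forall y, y \in B -> (#|[set x in A | f x == y]| <= k)%N) ->
  (#|A| <= #|B| * k)%N.
Proof.
by move=> fk; rewrite card_fibres_sum -sum_nat_const; apply: leq_sum.
Qed.
End Fibres.

Section Frobenius.
Variables (K : finFieldType) (q : nat).
Hypothesis cardK : #|K| = (q ^ 4)%N.
Implicit Types x y z : K.

Definition frob (x : K) : K := x ^+ q.
Local Notation fr := frob.

Lemma q_gt1 : (1 < q)%N.
Proof.
have := finNzRing_gt1 K; rewrite cardK.
by case: q => [|[|n]] //; rewrite exp1n.
Qed.

(** The order [q ^ 4] of [K] is a power of the characteristic, hence so is [q]; this is what makes
    [frob] additive. *)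
Lemma q_pchar : [pchar K].-nat q.
Proof.
have [p p_pr pK] := finPcharP K.
rewrite (eq_pnat _ (pcharf_eq pK)).
have : p.-nat #|[set: K]| := pprimeChar_pgroup pK.
by rewrite cardsT cardK pnatX orbF.
Qed.

Lemma frobD x y : fr (x + y) = fr x + fr y.
Proof. exact: exprDn_pchar q_pchar. Qed.
Lemma frobM x y : fr (x * y) = fr x * fr y. Proof. exact: exprMn. Qed.
Lemma frob0 : fr 0 = 0. Proof. by rewrite /frob expr0n eqn0Ngt ltnW ?q_gt1. Qed.
Lemma frob1 : fr 1 = 1. Proof. exact: expr1n. Qed.
Lemma frobN x : fr (- x) = - fr x.
Proof. by apply/eqP; rewrite -subr_eq0 opprK -frobD addNr frob0. Qed.
Lemma frobB x y : fr (x - y) = fr x - fr y.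
Proof. by rewrite frobD frobN. Qed.
Lemma frobV x : fr x^-1 = (fr x)^-1. Proof. exact: exprVn. Qed.
Lemma frob_eq0 x : (fr x == 0) = (x == 0).
Proof. by rewrite /frob expf_eq0 ltnW ?q_gt1. Qed.
Lemma frob_inj : injective fr.
Proof.
by move=> x y /eqP; rewrite -subr_eq0 -frobB frob_eq0 subr_eq0 => /eqP.
Qed.
Lemma frob4 x : fr (fr (fr (fr x))) = x.
Proof. by rewrite /frob -!exprM -[RHS]expf_card cardK. Qed.
Lemma frob_sum I (r : seq I) P (E : I -> K) :
  fr (\sum_(i <- r | P i) E i) = \sum_(i <- r | P i) fr (E i).
Proof. by apply: (big_morph fr frobD frob0). Qed.

Definition norm x := x * fr x * fr (fr x) * fr (fr (fr x)).

Lemma normM x y : norm (x * y) = norm x * norm y.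
Proof. by rewrite /norm !frobM; ring. Qed.
Lemma norm_frob x : norm (fr x) = norm x.
Proof. by rewrite /norm frob4; ring. Qed.
Lemma norm_eq0 x : (norm x == 0) = (x == 0).
Proof. by rewrite /norm !mulf_eq0 !frob_eq0 !orbb. Qed.
Lemma normE x : norm x = x ^+ (1 + q + q ^ 2 + q ^ 3).
Proof. by rewrite /norm /frob -!exprM !exprD expr1 !expnS expn0 !muln1 !mulnA. Qed.
Lemma normV x : norm x^-1 = (norm x)^-1. Proof. by rewrite !normE exprVn. Qed.
Lemma normN x : norm (- x) = norm x.
Proof. by rewrite /norm !frobN; ring. Qed.

Lemma prim_generator : exists g : K, (q ^ 4).-1.-primitive_root g.
Proof.
have K1 := finNzRing_gt1 K.
pose rs := enum [pred x : K | x != 0].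
have : has (q ^ 4).-1.-primitive_root rs.
  rewrite -cardK; apply: has_prim_root; rewrite ?enum_uniq ?ltn_predRL //.
    apply/allP=> x; rewrite mem_enum inE unity_rootE => x0.
    apply/eqP/(mulfI x0); rewrite -exprS prednK ?expf_card ?mulr1 //.
    exact: ltnW.
  by rewrite -cardE (cardC1 (0 : K)).
by case/hasP=> g _ gP; exists g.
Qed.

Lemma q4B1 : (q ^ 4).-1 = ((q - 1) * (1 + q + q ^ 2 + q ^ 3))%N.
Proof. have := q_gt1; nia. Qed.

Lemma power_of_generator g x : (q ^ 4).-1.-primitive_root g -> x != 0 ->
  exists k, x = g ^+ k.
Proof.
move=> gP x0; have K1 := finNzRing_gt1 K.
have xq : x ^+ (q ^ 4).-1 = 1.
  by apply/(mulfI x0); rewrite -exprS -cardK prednK ?expf_card ?mulr1 // ltnW.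
by have [i ->] := prim_rootP gP xq; exists i.
Qed.

Lemma generator_neq0 (g : K) : (q ^ 4).-1.-primitive_root g -> g != 0.
Proof.
move=> gP; have n0 := prim_order_gt0 gP.
apply/eqP => g0; have /eqP := prim_expr_order gP; rewrite g0.
by rewrite expr0n gtn_eqF // eq_sym oner_eq0.
Qed.

(** Write x = g^k for a generator g of the multiplicative group. Norm 1 forces q - 1 to divide k,
    say k = j (q - 1), and y = g^j works. *)
Lemma hilbert90 x : norm x = 1 -> exists2 y, y != 0 & x = fr y / y.
Proof.
move=> Nx; have [g gP] := prim_generator.
have x0 : x != 0 by rewrite -norm_eq0 Nx oner_neq0.
have [k xE] := power_of_generator gP x0.
have := q_gt1; set m := (1 + q + q ^ 2 + q ^ 3)%N => q1.
have m0 : (0 < m)%N by rewrite /m.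
have : ((q ^ 4).-1 %| k * m)%N.
  by rewrite (prim_order_dvd gP) exprM -xE -normE Nx.
rewrite q4B1 dvdn_pmul2r // => /dvdnP[j kE].
have g0 := generator_neq0 gP.
exists (g ^+ j); first by rewrite expf_neq0.
apply: (canRL (mulfK _)); first by rewrite expf_neq0.
by rewrite xE kE /frob -exprM -exprD -mulnSr subn1 prednK // ltnW.
Qed.

(** For nonzero x = g^k with x^(q - 1) = 1, the exponent is k = j (q^2 + 1)(q + 1). The element g^(j
    (q^2 + 1)) lies in the field of order q^2, and its power q + 1 is x. *)
Lemma norm_quadratic_surj x : fr x = x ->
  exists2 c, fr (fr c) = c & c * fr c = x.
Proof.
move=> xF; have [-> | x0] := eqVneq x 0; first by exists 0; rewrite ?frob0 ?mul0r.
have [g gP] := prim_generator; have g0 := generator_neq0 gP.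
have [k xE] := power_of_generator gP x0; have q1 := q_gt1.
have : ((q ^ 4).-1 %| k * (q - 1))%N.
  rewrite (prim_order_dvd gP) exprM -xE -(inj_eq (mulfI x0)) -exprS mulr1.
  by rewrite subn1 prednK ?(ltnW q1) // -/(frob x) xF.
rewrite q4B1 [(k * _)%N]mulnC dvdn_pmul2l ?subn_gt0 // => /dvdnP[j kE].
have gq : g ^+ (q ^ 4) = g.
  by rewrite -[RHS]expf_card cardK.
exists (g ^+ (j * (q ^ 2 + 1))).
  rewrite /frob -!exprM (_ : (j * (q ^ 2 + 1) * (q * q) = q ^ 4 * j + j * q ^ 2)%N); last by ring.
  by rewrite exprD exprM gq -exprD mulnDr muln1 addnC.
rewrite /frob -exprM -exprD xE; congr (g ^+ _); rewrite kE; ring.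
Qed.

Definition tr x := x + fr x + fr (fr x) + fr (fr (fr x)).

Lemma frob_tr x : fr (tr x) = tr x.
Proof. by rewrite /tr !frobD frob4; ring. Qed.

Lemma card_roots_le (p : {poly K}) (A : {set K}) : p != 0 ->
  (forall x, x \in A -> root p x) -> (#|A| < size p)%N.
Proof.
move=> p0 rA; rewrite cardE; apply: max_poly_roots => //; last exact: enum_uniq.
by apply/allP=> x; rewrite mem_enum; apply: rA.
Qed.

Lemma card_fixed_le n : (0 < n)%N ->
  (#|[set x : K | x ^+ (q ^ n) == x]| <= q ^ n)%N.
Proof.
move=> n0; have qn : (1 < q ^ n)%N by rewrite -(exp1n n) ltn_exp2r ?q_gt1.
have sz : size ('X^(q ^ n) - 'X : {poly K}) = (q ^ n).+1.
  by rewrite size_polyDl size_polyXn // size_polyN size_polyX.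
rewrite -ltnS -sz; apply: card_roots_le.
  by rewrite -size_poly_eq0 sz.
by move=> x; rewrite inE rootE !hornerE subr_eq0.
Qed.

Lemma exists_not_fixed2 : exists x, fr (fr x) != x.
Proof.
apply/existsP; apply: contraT => /existsPn fx.
have := card_fixed_le (isT : (0 < 2)%N).
rewrite (_ : [set _ | _] = setT); last first.
  by apply/setP=> x; rewrite !inE; have := fx x; rewrite negbK /frob -exprM.
by rewrite cardsT cardK leqNgt ltn_exp2l ?q_gt1.
Qed.

(* The map y |-> y - y^q has at least q^4 / q values, all of them roots of     *)
(* X + X^q + X^(q^2) + X^(q^3), which has degree q^3.                         *)
Lemma additive_hilbert90 x : tr x = 0 -> exists y, x = y - fr y.
Proof.
move=> trx; pose f y := y - fr y; pose I := [set f y | y : K].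
have q1 := q_gt1.
pose T := [set y | tr y == 0]; have sIT : I \subset T.
  by apply/subsetP=> _ /imsetP[y _ ->]; rewrite inE /f /tr !frobB frob4; apply/eqP; ring.
have cT : (#|T| <= q ^ 3)%N.
  pose p : {poly K} := 'X^(q ^ 3) + ('X^(q ^ 2) + ('X^q + 'X)).
  have sz1 : size ('X^q + 'X : {poly K}) = q.+1.
    by rewrite size_polyDl size_polyXn // size_polyX.
  have lt2 : (q < q ^ 2)%N by rewrite -{1}(expn1 q) ltn_exp2l.
  have sz2 : size ('X^(q ^ 2) + ('X^q + 'X) : {poly K}) = (q ^ 2).+1.
    by rewrite size_polyDl size_polyXn // sz1.
  have sz : size p = (q ^ 3).+1.
    by rewrite size_polyDl size_polyXn // sz2 ltnS ltn_exp2l.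
  rewrite -ltnS -sz; apply: card_roots_le; first by rewrite -size_poly_eq0 sz.
  move=> y; rewrite inE rootE !hornerD !hornerXn hornerX /tr /frob -!exprM => /eqP E.
  rewrite !expnS expn0 !muln1 !mulnA -E;  apply/eqP; ring.
have cI : (q ^ 3 <= #|I|)%N.
  have : (#|K| <= #|I| * q)%N.
    rewrite -cardsT; apply: (card_fibres_le (f := f)) => [y _|z _].
      exact: imset_f.
    have [->|[y0 y0z]] := set_0Vmem [set y in [set: K] | f y == z]; first by rewrite cards0.
    have /eqP fy0 : f y0 == z by move: y0z; rewrite !inE.
    rewrite -(card_imset _ (addIr (- y0))) -[leqRHS]expn1.
    apply: leq_trans (card_fixed_le _) => //; apply: subset_leq_card.
    apply/subsetP=> t /imsetP[y yz ->]; move: yz; rewrite !inE expn1 -/(frob _) frobB => /eqP fy.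
    rewrite -subr_eq0; apply/eqP; transitivity (f y0 - f y); first by rewrite /f; ring.
    by rewrite fy0 fy subrr.
  by rewrite cardK expnSr leq_pmul2r // ltnW.
have /eqP IE : I == T by rewrite eqEcard sIT (leq_trans cT).
have : x \in I by rewrite IE inE trx.
by case/imsetP=> y _ ->; exists y.
Qed.

(* Over the quadratic subfield the form [tr (z * x * frob x)] is a Hermitian  *)
(* form in two variables: a vector orthogonal to 1 completes the norm.        *)
Lemma hermitian_isotropic z : z != 0 ->
  exists2 x, x != 0 & tr (z * x * fr x) = 0.
Proof.
move=> z0; pose Q x := tr (z * x * fr x).
have [Q1|Q1] := eqVneq (Q 1) 0; first by exists 1; rewrite ?oner_neq0.
(* For c in the quadratic subfield, Q(c + y) equals c c^q Q(1) + Q(y) + c^q e + c e^q, where e = m y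
   + (m y)^(q^2). Hence e = 0 means that [y] is orthogonal to that subfield, and choosing [y]
   outside it keeps c + y nonzero. *)
pose m := z + fr (fr (fr z)).
have [y ny my] : exists2 y, fr (fr y) != y & m * y + fr (fr (m * y)) = 0.
  have [m0 | m0] := eqVneq m 0.
    have [y ny] := exists_not_fixed2; exists y => //.
    by rewrite m0 mul0r !frob0 addr0.
  have [k nk] := exists_not_fixed2; pose d := k - fr (fr k).
  pose y := d / m; have md : m * y = d by rewrite mulrC divfK.
  have Ey : m * y + fr (fr (m * y)) = 0 by rewrite md /d !frobB frob4; ring.
  (* If [y] were in the quadratic subfield, the relation [Ey] would read y Q(1) = 0. *)
  exists y => //; apply: contraNneq Q1 => fy.
  have y0 : y != 0 by rewrite mulf_neq0 ?invr_eq0 // subr_eq0 eq_sym.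
  apply/eqP/(mulIf y0); rewrite mul0r -Ey; clearbody y; rewrite !frobM fy /Q /m /tr !(frobM, frobD, frob1, frob4).
  ring.
have [c cE cN] : exists2 c, fr (fr c) = c & c * fr c = - Q y / Q 1.
  apply: norm_quadratic_surj; rewrite frobM frobN frobV !frob_tr //.
exists (c + y).
  apply: contraNneq ny => /eqP; rewrite addr_eq0 => /eqP cy.
  by apply/eqP/oppr_inj; rewrite -!frobN -cy.
transitivity (c * fr c * Q 1 + Q y + fr c * (m * y + fr (fr (m * y))) + c * (fr (m * y) + fr (fr (fr (m * y))))).
  rewrite /Q /m /tr !(frobM, frobD, frob1, frob4, cE); ring.
rewrite cN divfK // my -frobD my frob0; ring.
Qed.

Definition twist a b x := a * fr x + b * fr (fr (fr x)).

(** With x = 1/u and y = v/u the equation, multiplied by u, becomes a u^(-q) (v - v^q) + b u^(-q^3)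
    (v - v^(q^3)) = 0. For nonzero a, Hilbert 90 gives w with b w = a w^q. If v - v^q = w^q u^(q+1),
    the two summands are a w^q u and - b w u, which cancel. Such a v exists once w^q u^(q+1) has
    trace 0, and [hermitian_isotropic] supplies such a u. *)
Lemma twist_parallel a b : norm a = norm b ->
  exists x y, [/\ x != 0, fr (y / x) != y / x & y * twist a b x = x * twist a b y].
Proof.
move=> Nab; have [a0 | a0] := eqVneq a 0.
  have b0 : b = 0 by apply/eqP; rewrite -norm_eq0 -Nab a0 norm_eq0.
  have [y ny] := exists_not_fixed2; exists 1, y.
  rewrite oner_neq0 divr1; split=> //; last by rewrite /twist a0 b0; ring.
  by apply: contraNneq ny => fy; rewrite !fy.
have b0 : b != 0 by rewrite -norm_eq0 -Nab norm_eq0.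
have [|w w0 wE] := @hilbert90 (b / a).
  by rewrite normM normV Nab divff ?norm_eq0.
have Dw : b * w = a * fr w.
  by rewrite -[b](divfK a0) wE; field.
have fw0 : fr w != 0 by rewrite frob_eq0.
have [u u0 tru] := hermitian_isotropic fw0.
have [v vE] := additive_hilbert90 tru.
have fu0 : fr u != 0 by rewrite frob_eq0.
exists u^-1, (v / u); rewrite invr_eq0 u0 invrK divfK //.
have nv : fr v != v.
  by apply: contra_neq (mulf_neq0 (mulf_neq0 fw0 u0) fu0) => E; rewrite vE E subrr.
split=> //; apply/eqP; rewrite -subr_eq0 /twist !frobM !frobV.
have E1 : fr v = v - fr w * u * fr u by rewrite vE; ring.
have E2 : fr (fr (fr v)) = v + fr (fr (fr (fr w * u * fr u))).
  by rewrite vE !frobB frob4; ring.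
rewrite E2 !frobM !frob4 E1.
have f3u0 : fr (fr (fr u)) != 0 by rewrite !frob_eq0.
apply/eqP; transitivity ((a * fr w - b * w)); last by rewrite Dw subrr.
by field; rewrite u0 fu0 f3u0.
Qed.

Lemma norm_eq_of_parallel a b x y : x != 0 -> fr (y / x) != y / x ->
  y * twist a b x = x * twist a b y -> norm a = norm b.
Proof.
move=> x0 nyx E; pose z := fr x * y - x * fr y.
have fx0 : fr x != 0 by rewrite frob_eq0.
have z0 : z != 0.
  apply: contraNneq nyx => /eqP; rewrite subr_eq0 => /eqP zE.
  by rewrite frobM frobV; apply/eqP; field: zE; rewrite x0 fx0.
have Ez : a * z = b * fr (fr (fr z)).
  apply/eqP; rewrite -subr_eq0 /z !(frobB, frobM) !frob4; apply/eqP.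
  transitivity (y * twist a b x - x * twist a b y); first by rewrite /twist; ring.
  by rewrite E subrr.
apply: (mulIf (_ : norm z != 0)); first by rewrite norm_eq0.
by rewrite -normM Ez normM !norm_frob.
Qed.

(** Multiply the relation by its conjugate under the square of [frob]. It serves in [fibre_cases] to
    exclude words that mix the two generators of a code. *)
Lemma norm_eq_of_cross a b x : x != 0 ->
  a * fr a * fr x + b * fr (fr (fr b)) * fr (fr (fr x)) = 0 -> norm a = norm b.
Proof.
move=> x0 /eqP; rewrite addr_eq0 => /eqP E.
have E2 := congr1 (fun y => fr (fr y)) E.
rewrite !(frobN, frobM) !frob4 in E2.
apply: (mulIf (_ : fr x * fr (fr (fr x)) != 0)); first by rewrite mulf_neq0 ?frob_eq0.
transitivity ((a * fr a * fr x) * (fr (fr a) * fr (fr (fr a)) * fr (fr (fr x)))).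
  by rewrite /norm; ring.
by rewrite E E2 /norm; ring.
Qed.

(** Each side times its own conjugate is a norm. This keeps the factor in [tw_swap] from
    vanishing. *)
Lemma norm_eq_of_half a b : fr a * fr (fr (fr a)) = fr b * fr (fr (fr b)) ->
  norm a = norm b.
Proof.
move=> E; have := congr1 fr E; rewrite !frobM !frob4 => E'.
transitivity ((fr a * fr (fr (fr a))) * (fr (fr a) * a)); first by rewrite /norm; ring.
by rewrite E E' /norm; ring.
Qed.

Lemma card_norm1 : #|[set x | norm x == 1]| = (1 + q + q ^ 2 + q ^ 3)%N.
Proof.
set m := (1 + _ + _ + _)%N; have [g gP] := prim_generator.
have m_dvd : (m %| (q ^ 4).-1)%N by rewrite q4B1 dvdn_mull.
have hP := dvdn_prim_root gP m_dvd; set h := g ^+ _ in hP.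
rewrite -[RHS]card_ord -(card_imset predT (f := fun i : 'I_m => h ^+ i)); last first.
  move=> i j /eqP; rewrite (eq_prim_root_expr hP) !modn_small // => /eqP.
  exact: val_inj.
apply: eq_card => x; rewrite inE normE; apply/eqP/imsetP => [/(prim_rootP hP)[i ->]|[i _ ->]].
  by exists i.
by rewrite exprAC (prim_expr_order hP) expr1n.
Qed.

(** Pairs of equal norm are (0, 0) and, for each nonzero a, the pairs (a, a c) with c of norm 1. *)
Lemma card_norm_neq :
  (#|[set p : K * K | norm p.1 != norm p.2]| + (q ^ 4 - 1) * (1 + q + q ^ 2 + q ^ 3) + 1
   = q ^ 4 * q ^ 4)%N.
Proof.
pose E := [set p : K * K | norm p.1 == norm p.2].
suff cE : #|E| = ((q ^ 4 - 1) * (1 + q + q ^ 2 + q ^ 3) + 1)%N.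
  have -> : (q ^ 4 * q ^ 4 = #|{: K * K}|)%N by rewrite card_prod cardK.
  rewrite -addnA -cE addnC -(cardC E); congr (_ + _)%N.
  by apply: eq_card => p; rewrite !inE.
rewrite (card_fibres_sum (B := setT) (f := fst)); last by move=> p; rewrite inE.
rewrite (bigD1 (0 : K)) ?inE //= addnC; congr (_ + _)%N.
  rewrite -card_norm1 (eq_bigr (fun=> #|[set x | norm x == 1]|)); last first.
    move=> a /andP[_ a0]; rewrite -(card_imset _ (f := fun c => (a, a * c))); last first.
      by move=> c d [/(mulfI a0)].
    apply: eq_card => -[a' b]; rewrite !inE /=; apply/andP/imsetP=> [[N /eqP a'E]|[c]].
      rewrite {}a'E in N *; exists (b / a); last by rewrite mulrC divfK.
      by rewrite inE normM normV -(eqP N) divff ?norm_eq0.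
    by rewrite inE => /eqP Nc [-> ->]; rewrite normM Nc mulr1 !eqxx.
  rewrite sum_nat_const; congr (_ * _)%N; rewrite -cardK subn1 -(cardC1 (0 : K)).
  by apply: eq_card => x; rewrite -topredE /= !inE.
transitivity #|[set (0 : K, 0 : K)]|; last exact: cards1.
apply: eq_card => -[a b]; rewrite !inE /= xpair_eqE.
rewrite andbC; have [->|//] := eqVneq a 0 => /=.
have N0 : norm 0 = 0 by apply/eqP; rewrite norm_eq0.
by rewrite N0 eq_sym norm_eq0.
Qed.

(** A polynomial of degree at most q^3 cannot have q^4 roots unless it is zero, and the exponents
    q^i are distinct, so each coefficient can be read off. *)
Lemma linearized_eq0 c0 c1 c2 c3 :
  (forall x, c0 * x + c1 * fr x + c2 * fr (fr x) + c3 * fr (fr (fr x)) = 0) ->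
  [/\ c0 = 0, c1 = 0, c2 = 0 & c3 = 0].
Proof.
move=> E; have q1 := q_gt1.
pose p : {poly K} := c0 *: 'X^(q ^ 0) + c1 *: 'X^(q ^ 1) + c2 *: 'X^(q ^ 2) + c3 *: 'X^(q ^ 3).
have p0 : p = 0.
  apply: contraTeq isT => p0.
  have sz c i : (i <= 3)%N -> (size (c *: 'X^(q ^ i) : {poly K})%R <= (q ^ 3).+1)%N.
    by move=> i3; rewrite (leq_trans (size_scale_leq _ _)) // size_polyXn ltnS leq_exp2l.
  have szp : (size p <= (q ^ 3).+1)%N.
    by do 3!rewrite (leq_trans (size_polyD _ _)) // geq_max sz ?andbT //; apply: sz.
  have rp x : x \in [set: K] -> root p x.
    rewrite rootE !hornerD !hornerZ !hornerXn => _; apply/eqP; rewrite -[RHS](E x).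
    by rewrite /frob -!exprM !expnS expn0 !muln1 expr1 !mulnA.
  have := leq_trans (card_roots_le p0 rp) szp.
  by rewrite cardsT cardK ltnS leq_exp2l.
have cf i : (i <= 3)%N -> nth 0 [:: c0; c1; c2; c3] i = 0.
  move=> i3; have := congr1 (fun r : {poly K} => r`_(q ^ i)) p0.
  rewrite !coefD !coefZ !coefXn coef0 !eqn_exp2l //.
  by case: i i3 => [|[|[|[|i]]]] //= _; rewrite !(mulr0, mulr1, addr0, add0r).
by split; [apply: (cf 0%N)|apply: (cf 1%N)|apply: (cf 2%N)|apply: (cf 3%N)].
Qed.
End Frobenius.

(** * Alternating forms in four variables *)

Section Pfaffian.

Lemma sum_inord (V : zmodType) n (f : 'I_n.+1 -> V) :
  \sum_i f i = \sum_(0 <= i < n.+1) f (inord i).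
Proof. by rewrite big_mkord; apply: eq_bigr => i _; rewrite inord_val. Qed.

Lemma forall_inord n (P : 'I_n.+1 -> Prop) :
  (forall i, (i < n.+1)%N -> P (inord i)) -> forall i, P i.
Proof. by move=> H i; rewrite -[i]inord_val; apply: H. Qed.

Local Notation "x `[ i ]" := (x 0 (inord i)) (at level 2, format "x `[ i ]").

Section Ring.
Variable K : comNzRingType.
Implicit Types (p r : 'rV[K]_6) (u g h : 'rV[K]_4).

(* Coordinates of bivectors are listed in the order 01, 02, 03, 12, 13, 23.   *)
Definition alt_rows p : seq (seq K) :=
  [:: [:: 0; p`[0]; p`[1]; p`[2]];
      [:: - p`[0]; 0; p`[3]; p`[4]];
      [:: - p`[1]; - p`[3]; 0; p`[5]];
      [:: - p`[2]; - p`[4]; - p`[5]; 0]].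
Definition altmx p : 'M[K]_4 :=
  \matrix_(i, j) nth 0 (nth [::] (alt_rows p) i) j.
Definition pfaffian p := p`[0] * p`[5] - p`[1] * p`[4] + p`[2] * p`[3].
(** The Hodge dual of a bivector: up to the factor - Pf(p), [altmx (dual p)] is inverse to [altmx p]
    ([altmx_dual]). *)
Definition dual p : 'rV[K]_6 :=
  \row_i [:: p`[5]; - p`[4]; p`[3]; p`[2]; - p`[1]; p`[0]]`_i.
Definition wedge g h : 'rV[K]_6 :=
  \row_i [:: g`[0] * h`[1] - g`[1] * h`[0]; g`[0] * h`[2] - g`[2] * h`[0];
             g`[0] * h`[3] - g`[3] * h`[0]; g`[1] * h`[2] - g`[2] * h`[1];
             g`[1] * h`[3] - g`[3] * h`[1]; g`[2] * h`[3] - g`[3] * h`[2]]`_i.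

Lemma row_altmxE u p (j : nat) : (j < 4)%N ->
  (u *m altmx p)`[j] =
   [:: - u`[1] * p`[0] - u`[2] * p`[1] - u`[3] * p`[2];
       u`[0] * p`[0] - u`[2] * p`[3] - u`[3] * p`[4];
       u`[0] * p`[1] + u`[1] * p`[3] - u`[3] * p`[5];
       u`[0] * p`[2] + u`[1] * p`[4] + u`[2] * p`[5]]`_j.
Proof.
move=> j4; rewrite mxE sum_inord /index_iota /= !big_cons big_nil !mxE !inordK //.
by case: j j4 => [|[|[|[|]]]] //= _; ring.
Qed.

Lemma altmxE p (i j : nat) : (i < 4)%N -> (j < 4)%N ->
  altmx p (inord i) (inord j) = nth 0 (nth [::] (alt_rows p) i) j.
Proof. by move=> i4 j4; rewrite mxE !inordK. Qed.

Lemma row6E (f : nat -> K) (i : nat) : (i < 6)%N -> (\row_(i < 6) f i)`[i] = f i.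
Proof. by move=> i6; rewrite mxE inordK. Qed.

Lemma altmx_diag p i : altmx p i i = 0.
Proof.
by elim/forall_inord: i => -[|[|[|[|]]]] // i4; rewrite altmxE.
Qed.

Lemma altmx_anti p i j : altmx p i j = - altmx p j i.
Proof.
elim/forall_inord: i => i i4; elim/forall_inord: j => j j4; rewrite !altmxE //.
by case: i i4 => [|[|[|[|]]]] // _; case: j j4 => [|[|[|[|]]]] //= _; rewrite ?oppr0 ?opprK.
Qed.

Definition polar p r :=
  p`[0] * r`[5] + r`[0] * p`[5] - (p`[1] * r`[4] + r`[1] * p`[4])
  + (p`[2] * r`[3] + r`[2] * p`[3]).

Lemma pfaffianB p r x :
  pfaffian (p - x *: r) = pfaffian p - x * polar p r + x ^+ 2 * pfaffian r.
Proof. by rewrite /pfaffian /polar !mxE; ring. Qed.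

Lemma altmxB p r x : altmx (p - x *: r) = altmx p - x *: altmx r.
Proof.
apply/matrixP; elim/forall_inord => i i4; elim/forall_inord => j j4.
have -> (A B : 'M[K]_4) k l : (A - x *: B) k l = A k l - x * B k l by rewrite !mxE.
rewrite !altmxE // /alt_rows !mxE.
by case: i i4 => [|[|[|[|]]]] // _; case: j j4 => [|[|[|[|]]]] //= _; ring.
Qed.

Lemma altmx_dual p : altmx p *m altmx (dual p) = (- pfaffian p)%:M.
Proof.
apply/row_matrixP=> i; apply/rowP; elim/forall_inord => j j4.
elim/forall_inord: i => i i4; rewrite row_mul row_altmxE // !row6E // !mxE !inordK //.
by case: i i4 => [|[|[|[|]]]] // _; case: j j4 => [|[|[|[|]]]] //= _;
  rewrite -?val_eqE /= ?inordK // /pfaffian ?mulr1n ?mulr0n; ring.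
Qed.

(* For an alternating form w = x^y of rank 2 this says that the second        *)
(* exterior power of w is w (x) w.                                            *)
Lemma minor_altmx p g h k l :
  (g *m altmx p) 0 k * (h *m altmx p) 0 l - (g *m altmx p) 0 l * (h *m altmx p) 0 k
  = (\sum_i p 0 i * wedge g h 0 i) * altmx p k l
    - pfaffian p * altmx (dual (wedge g h)) k l.
Proof.
elim/forall_inord: k => k k4; elim/forall_inord: l => l l4; rewrite !row_altmxE //.
rewrite sum_inord /index_iota /= !big_cons big_nil !altmxE // /alt_rows !row6E //=.
by case: k k4 => [|[|[|[|]]]] // _; case: l l4 => [|[|[|[|]]]] //= _;
  rewrite /pfaffian; ring.
Qed.
End Ring.

Section Field.
Variable K : fieldType.
Implicit Types (p r : 'rV[K]_6) (u g h : 'rV[K]_4).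

Lemma altmx_inj p u : pfaffian p != 0 -> u *m altmx p = 0 -> u = 0.
Proof.
move=> pf0 up0; apply: (scalerI pf0); rewrite scaler0 -[pfaffian p]opprK scaleNr.
by rewrite -mul_mx_scalar -altmx_dual mulmxA up0 mul0mx oppr0.
Qed.

(** Under the two hypotheses [minor_altmx] makes all 2 x 2 minors of the images of g and h vanish.
    These images are then proportional, so the radical of the form meets the span of g and h. *)
Lemma degenerate_isotropic p g h : pfaffian p = 0 ->
    \sum_i p 0 i * wedge g h 0 i = 0 ->
  exists s t, (s != 0) || (t != 0) /\ (s *: g + t *: h) *m altmx p = 0.
Proof.
move=> pf0 gh0; set x := g *m altmx p; set y := h *m altmx p.
have minor0 k l : x 0 k * y 0 l = x 0 l * y 0 k.
  by apply/eqP; rewrite -subr_eq0 minor_altmx pf0 gh0 !mul0r subr0.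
have [x0 | /rV0Pn[k xk]] := eqVneq x 0.
  by exists 1, 0; rewrite oner_neq0 scale1r scale0r addr0.
exists (- y 0 k), (x 0 k); rewrite xk orbT; split=> //.
rewrite mulmxDl -!scalemxAl -/x -/y; clearbody x y.
by apply/rowP=> l; rewrite !mxE minor0; ring.
Qed.
End Field.

Lemma altmx_map (K K' : comNzRingType) (f : {rmorphism K -> K'}) (p : 'rV[K]_6) :
  altmx (map_mx f p) = map_mx f (altmx p).
Proof.
apply/matrixP; elim/forall_inord => i i4; elim/forall_inord => j j4.
rewrite [RHS]mxE !altmxE // /alt_rows !mxE.
by case: i i4 => [|[|[|[|]]]] // _; case: j j4 => [|[|[|[|]]]] //= _;
  rewrite ?rmorph0 ?rmorphN.
Qed.

Lemma pfaffian_map (K K' : comNzRingType) (f : {rmorphism K -> K'}) (p : 'rV[K]_6) :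
  pfaffian (map_mx f p) = f (pfaffian p).
Proof. by rewrite /pfaffian !mxE rmorphD rmorphB !rmorphM. Qed.

End Pfaffian.

(** * Rank and the codes <u, a u^q + b u^(q^3)> *)

Section Pairs.
Variables (K : fieldType) (V : vectType K).
Implicit Types x y z : V.

Lemma mem_span2 x y z :
  reflect (exists s t, z = s *: x + t *: y) (z \in <<[:: x; y]>>%VS).
Proof.
rewrite span_cons span_seq1; apply: (iffP memv_addP).
  by case=> _ /vlineP[s ->] [_ /vlineP[t ->] ->]; exists s, t.
by case=> s [t ->]; exists (s *: x); rewrite ?memvZ ?memv_line //;
  exists (t *: y); rewrite ?memvZ ?memv_line.
Qed.

Lemma free2 x y : free [:: x; y] = (x != 0) && (y \notin <[x]>%VS).
Proof.
have /perm_free-> : perm_eq [:: x; y] [:: y; x] by rewrite (perm_catC [:: x] [:: y]).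
by rewrite free_cons seq1_free span_seq1 andbC.
Qed.

Lemma free2P x y : reflect (forall s t, s *: x + t *: y = 0 -> s = 0 /\ t = 0)
  (free [:: x; y]).
Proof.
rewrite free2; apply: (iffP andP) => [[x0 nyx] s t E | inj]; last first.
  split; first by apply: contraTneq isT => x0; have [|/eqP] := inj 1 0;
    rewrite ?x0 ?scaler0 ?scale0r ?addr0 // oner_eq0.
  apply/negP => /vlineP[k yE]; have [|_ /eqP] := inj (- k) 1; last by rewrite oner_eq0.
  by rewrite yE scaleNr scale1r addNr.
have t0 : t = 0.
  apply: contraNeq nyx => t0; apply/vlineP; exists (- (s / t)).
  apply: (scalerI t0); rewrite scalerA mulrN mulrC divfK // scaleNr.
  by apply/eqP; rewrite -addr_eq0 addrC E.
move: E; rewrite t0 scale0r addr0 => /eqP.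
by rewrite scaler_eq0 (negPf x0) orbF => /eqP.
Qed.

Lemma span2_scale x y (k l : K) : k != 0 -> l != 0 ->
  <<[:: k *: x; l *: y]>>%VS = <<[:: x; y]>>%VS.
Proof.
move=> k0 l0; apply/vspaceP => z; apply/mem_span2/mem_span2 => -[s [t ->]].
  by exists (s * k), (t * l); rewrite !scalerA.
by exists (s / k), (t / l); rewrite !scalerA !divfK.
Qed.

Lemma exists_free2 (U : {vspace V}) : (1 < \dim U)%N ->
  exists x y, [/\ x \in U, y \in U & free [:: x; y]].
Proof.
move=> U1; have : (1 < size (vbasis U))%N by rewrite size_tuple.
have := basis_free (vbasisP U).
have : {subset tval (vbasis U) <= U} by move=> v; apply: vbasis_mem.
case: (tval (vbasis U)) => [|x [|y s]] //= mU xys_free _; exists x, y; split.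
- by rewrite mU // mem_head.
- by rewrite mU // !inE eqxx orbT.
- exact: (@catl_free _ _ s [:: x; y] xys_free).
Qed.

Lemma span_free2 (U : {vspace V}) x y : \dim U = 2%N -> x \in U -> y \in U ->
  free [:: x; y] -> U = <<[:: x; y]>>%VS.
Proof.
move=> U2 xU yU xy_free; apply/eqP; rewrite eq_sym eqEdim (eqnP xy_free) U2 leqnn andbT.
by apply/span_subvP=> z; rewrite !inE => /pred2P[]->.
Qed.

End Pairs.

Section RankFour.
Variables (F : finFieldType) (L0 : fieldExtType F).
Local Notation L := (finvect_type L0).
Local Notation q := #|F|.
Local Notation fr := (@frob L q).
Implicit Types (u v w : 'rV[L]_4) (c d : 'rV[F]_4).

Lemma frob_scale (k : F) (x : L) : fr (k *: x) = k *: fr x.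
Proof. by rewrite /frob exprZn expf_card. Qed.

Lemma frob_fixed (x : L) : fr x = x -> exists k : F, x = k%:A.
Proof.
move=> fx; have := congr1 (map_poly (in_alg L)) (finField_genPoly F).
rewrite rmorphB /= map_polyXn map_polyX rmorph_prod /= => E.
have : root ('X^q - 'X) x by rewrite rootE !hornerE subr_eq0; apply/eqP.
rewrite E rootE horner_prod => /eqP/eqP; rewrite prodf_seq_eq0 => /hasP[k _].
rewrite /= rmorphB /= map_polyX map_polyC /= !hornerE subr_eq0 => /eqP xk.
by exists k.
Qed.

(** The image of this F-linear map is the span that defines [rk], so its kernel, the relations over
    F between the entries of [u], has dimension [n - rk u]. By [ev_vfrob] and [ev_scale], identities
    between conjugates of vectors become identities in [L]. *)
Definition ev n (u : 'rV[L]_n) (c : 'rV[F]_n) : L := \sum_j c 0 j *: u 0 j.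

Lemma ev_is_linear n (u : 'rV[L]_n) : linear (ev u).
Proof.
move=> k c d; rewrite /ev scaler_sumr -big_split; apply: eq_bigr => j _.
by rewrite !mxE scalerDl scalerA.
Qed.
HB.instance Definition _ n (u : 'rV[L]_n) :=
  GRing.isLinear.Build F 'rV[F]_n L _ (ev u) (ev_is_linear u).

Lemma ev_add n (u v : 'rV[L]_n) (c : 'rV[F]_n) : ev (u + v) c = ev u c + ev v c.
Proof. by rewrite /ev -big_split; apply: eq_bigr => j _; rewrite mxE scalerDr. Qed.

Lemma ev_scale n (a : L) (u : 'rV[L]_n) (c : 'rV[F]_n) : ev (a *: u) c = a * ev u c.
Proof. by rewrite /ev mulr_sumr; apply: eq_bigr => j _; rewrite mxE -scalerAr. Qed.

Lemma limg_ev n (u : 'rV[L]_n) :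
  (limg (linfun (ev u)) = <<[seq u ord0 j | j : 'I_n]>>)%VS.
Proof.
apply/eqP; rewrite eqEsubv; apply/andP; split.
  apply/subvP=> _ /memv_imgP[c _ ->]; rewrite lfunE /= /ev.
  by apply: rpred_sum => j _; apply/rpredZ/memv_span/map_f; rewrite mem_enum.
apply/span_subvP=> _ /mapP[j _ ->]; have -> : u ord0 j = linfun (ev u) (delta_mx 0 j).
  rewrite lfunE /= /ev (bigD1 j) //= !mxE !eqxx scale1r big1 ?addr0 // => i ij.
  by rewrite mxE (negPf ij) andbF scale0r.
exact: memv_img (memvf _).
Qed.

Lemma rk_ev n (u : 'rV[L]_n) : (\dim (lker (linfun (ev u))) + rk u)%N = n.
Proof.
transitivity (\dim {: 'rV[F]_n}); last by rewrite dimvf /dim /= mul1n.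
by rewrite /rk -limg_ev -(limg_ker_dim (linfun (ev u)) fullv) capfv.
Qed.

Lemma rk_le2P u : reflect (exists c d, [/\ free [:: c; d], ev u c = 0 & ev u d = 0])
  (rk u <= 2)%N.
Proof.
have dk := rk_ev u; set k := lker _ in dk.
have kP c : (c \in k) = (ev u c == 0) by rewrite memv_ker lfunE.
apply: (iffP idP) => [r2 | [c [d [cd_free c0 d0]]]]; last first.
  have : (<<[:: c; d]>> <= k)%VS.
    by apply/span_subvP=> e; rewrite !inE kP => /pred2P[]->; apply/eqP.
  by move/dimvS; rewrite (eqnP cd_free) /=; lia.
have [|c [d [ck dk2 cd_free]]] := exists_free2 (U := k); first by lia.
by exists c, d; split=> //; apply/eqP; rewrite -kP.
Qed.

Lemma rk4P u : reflect (forall c, ev u c = 0 -> c = 0) (rk u == 4%N).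
Proof.
have dk := rk_ev u; set k := lker _ in dk.
have kP c : (c \in k) = (ev u c == 0) by rewrite memv_ker lfunE.
have -> : (rk u == 4%N) = (k == 0%VS) by rewrite -dimv_eq0; lia.
apply: (iffP eqP) => [k0 c /eqP | inj]; first by rewrite -kP k0 memv0 => /eqP.
apply/eqP; rewrite -subv0; apply/subvP=> c; rewrite kP => /eqP/inj->; exact: mem0v.
Qed.

Hypothesis dimL : \dim {: L0} = 4%N.

Lemma cardL : #|L| = (q ^ 4)%N.
Proof. by rewrite -dimL -(card_vspacef (Vector.on L)) card_vspace. Qed.

Lemma ev_surj u : rk u = 4%N -> forall x : L, exists c, ev u c = x.
Proof.
move/eqP/rk4P => inj x.
have ev_inj : injective (ev u).
  by move=> c d /eqP; rewrite -subr_eq0 -raddfB => /eqP/inj/eqP; rewrite subr_eq0 => /eqP.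
have [|g _ gK] := @inj_card_bij _ _ _ ev_inj.
  by rewrite card_mx cardL mul1n.
by exists (g x); rewrite gK.
Qed.

Definition vfrob u := map_mx fr u.

Lemma ev_vfrob u c : ev (vfrob u) c = fr (ev u c).
Proof.
rewrite /ev (frob_sum cardL); apply: eq_bigr => j _.
by rewrite frob_scale mxE.
Qed.

(** Through [ev], a vector of rank 4 takes every value in [L]. A relation between its conjugates is
    therefore a linearized polynomial vanishing on all of [L]. *)
Lemma conjugates_free u a0 a1 a2 a3 : rk u = 4%N ->
  a0 *: u + a1 *: vfrob u + a2 *: vfrob (vfrob u) + a3 *: vfrob (vfrob (vfrob u)) = 0 ->
  [/\ a0 = 0, a1 = 0, a2 = 0 & a3 = 0].
Proof.
move=> /ev_surj su E; apply: (linearized_eq0 cardL) => x.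
have [c <-] := su x; rewrite -!ev_vfrob -!ev_scale -!ev_add E.
by rewrite /ev big1 // => j _; rewrite mxE scaler0.
Qed.

Definition vtwist (a b : L) u := a *: vfrob u + b *: vfrob (vfrob (vfrob u)).

Lemma ev_vtwist a b u c : ev (vtwist a b u) c = twist q a b (ev u c).
Proof. by rewrite ev_add !ev_scale !ev_vfrob. Qed.

Lemma ev_ratio_not_fixed u c d : rk u = 4%N -> free [:: c; d] ->
  ev u c != 0 /\ fr (ev u d / ev u c) != ev u d / ev u c.
Proof.
move=> /eqP/rk4P inj cd_free.
move: cd_free; rewrite free2 => /andP[c0 cd_free].
have uc0 : ev u c != 0 by apply: contra_neq c0; apply: inj.
split=> //; apply: contraTneq cd_free => /frob_fixed[k dE].
have -> : d = k *: c.
  apply/eqP; rewrite -subr_eq0; apply/eqP/inj; rewrite raddfB /= linearZ /=.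
  by rewrite -[ev u d](divfK uc0) dE -scalerAl mul1r subrr.
by rewrite memvZ ?memv_line.
Qed.

(** Maximum rank distance codes: by the Singleton bound a plane in dimension 4 has distance at most
    3. *)
Definition mrd (C : {vspace 'rV[L]_4}) := (\dim C == 2) && (3 <= rk_dist C)%N.

Lemma mrdP C : reflect
  (\dim C = 2%N /\ forall w, w \in C -> w != 0 -> (2 < rk w)%N) (mrd C).
Proof.
apply: (iffP andP) => [[/eqP C2 dC]|[C2 rC]].
  have C0 : C != 0%VS by rewrite -dimv_eq0 C2.
  by split=> // w wC w0; apply: leq_trans dC _; have [_] := rk_distP C0; apply.
have C0 : C != 0%VS by rewrite -dimv_eq0 C2.
by have [[w [wC w0 <-]] _] := rk_distP C0; rewrite C2 rC.
Qed.

(** Suppose that s u + t v vanishes at independent c and d, where u takes the values x and y.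
    Eliminating s leaves t (y T(x) - x T(y)) = 0 for T = [twist q a b]. As x is nonzero, so is t,
    and [norm_eq_of_parallel] gives a contradiction. *)
Lemma mrd_vtwist u a b : rk u = 4%N -> norm q a != norm q b ->
  mrd <<[:: u; vtwist a b u]>>.
Proof.
move=> ru Nab; set v := vtwist a b u.
have ab0 : (a != 0) || (b != 0).
  by rewrite -negb_and; apply: contraNN Nab => /andP[/eqP-> /eqP->].
have comb0 s t : s *: u + t *: v = 0 -> s = 0 /\ t = 0.
  move=> E; have [|s0 ta _ tb] := @conjugates_free u s (t * a) 0 (t * b) ru.
    rewrite scale0r addr0 -!scalerA; rewrite -[RHS]E -addrA -scalerDr //.
  split=> //; apply/eqP; apply: contraLR ab0 => t0; rewrite negb_or !negbK.
  by rewrite -(inj_eq (mulfI t0)) ta mulr0 eqxx -(inj_eq (mulfI t0)) tb mulr0 eqxx.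
apply/mrdP; split.
  have : free [:: u; v].
    exact/free2P.
  by move/eqnP=> ->.
move=> w /mem_span2[s [t ->]] w0; rewrite ltnNge; apply/rk_le2P => -[c [d [cdF]]].
rewrite !ev_add !ev_scale !ev_vtwist => Ec Ed.
have [x0 nyx] := ev_ratio_not_fixed ru cdF.
move: x0 nyx Ec Ed; set x := ev u c; set y := ev u d => x0 nyx Ec Ed.
have t0 : t != 0.
  apply: contra_neq w0 => t0; move: Ec; rewrite t0 mul0r addr0 => /eqP.
  by rewrite mulf_eq0 (negPf x0) orbF => /eqP->; rewrite !scale0r addr0.
case/negP: Nab; apply/eqP/(norm_eq_of_parallel cardL x0 nyx)/(mulfI t0).
apply/eqP; rewrite -subr_eq0; apply/eqP.
transitivity (y * (s * x + t * twist q a b x) - x * (s * y + t * twist q a b y)).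
  by ring.
by rewrite Ec Ed !mulr0 subrr.
Qed.

Lemma norm_neq_of_mrd u a b : rk u = 4%N -> mrd <<[:: u; vtwist a b u]>> ->
  norm q a != norm q b.
Proof.
move=> ru /mrdP[]; set v := vtwist a b u => dimC rC.
apply/eqP => /(twist_parallel cardL)[x [y [x0 nyx E]]].
have [[c cx] [d dy]] := (ev_surj ru x, ev_surj ru y).
(* The coefficient is chosen so that [w] vanishes at [c]; by [E] it then vanishes at [d] as well. *)
pose w := - (twist q a b x / x) *: u + v.
have uv_free : free [:: u; v] by rewrite /free dimC.
have w0 : w != 0.
  apply: contraTneq uv_free => E0; apply/free2P => /(_ (- (twist q a b x / x)) 1).
  by rewrite scale1r => /(_ E0)[_ /eqP]; rewrite oner_eq0.
have : w \in <<[:: u; v]>>%VS by apply/mem_span2; exists (- (twist q a b x / x)), 1; rewrite scale1r.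
move/rC/(_ w0); rewrite ltnNge => /negP; apply; apply/rk_le2P; exists c, d.
split; last 2 first.
- by rewrite ev_add ev_scale ev_vtwist cx mulNr divfK ?addNr.
- rewrite ev_add ev_scale ev_vtwist dy; apply/(mulfI x0).
  rewrite mulr0 mulrDr -E; field; exact: x0.
rewrite free2; apply/andP; split.
  by apply: contra_neq x0 => c0; rewrite -cx c0 raddf0.
apply: contraNN nyx => /vlineP[k dE]; apply/eqP.
by rewrite -dy dE linearZ /= cx -scalerAl divff // frob_scale frob1.
Qed.

End RankFour.

(** * Every code of distance 3 has this form *)

Section Existence.
Variables (F : finFieldType) (L0 : fieldExtType F).
Hypothesis dimL : \dim {: L0} = 4%N.
Local Notation L := (finvect_type L0).
Local Notation q := #|F|.
Local Notation fr := (@frob L q).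
Local Notation emb := (map_mx (in_alg L)).
Implicit Types (u v w : 'rV[L]_4) (c d : 'rV[F]_4) (p : 'rV[F]_6).

Let cardL := cardL dimL.

(** Either [h] has a root in [F], or it is irreducible and F[X]/h has q^2 elements. In the second
    case X^(q^4) = X modulo [h], so [h] divides X^(q^4) - X, which splits over [L]. *)
Lemma irreducible_quadratic_root (h : {poly F}) :
  h \is monic -> size h = 3%N -> exists x : L, root (map_poly (in_alg L) h) x.
Proof.
move=> h_mon szh; have [/existsP[k hk]|/existsPn nroot] := boolP [exists k, root h k].
  by exists k%:A; apply: rmorph_root.
have h_irr : irreducible_poly h by apply: cubic_irreducible; rewrite ?szh.
have hI : monic_irreducible_poly h by split.
have h_dvd : h %| 'X^(q ^ 4) - 'X.
  pose X : {poly %/ h with hI} := in_qpoly h 'X.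
  have XE : X ^+ (q ^ 4) = X.
    have := expf_card X; rewrite card_qfpoly szh /= => XE.
    by rewrite (expnM q 2 2) expnS expn1 exprM !XE.
  have /eqP : in_qpoly h ('X^(q ^ 4) - 'X) = 0.
    by rewrite rmorphB rmorphXn /= -/X XE subrr.
  by rewrite -val_eqE /= mk_monicE ?dvdpE.
have : map_poly (in_alg L) h %| \prod_(x : L) ('X - x%:P).
  rewrite -finField_genPoly cardL -(map_polyX (in_alg L)) -rmorphXn -rmorphB /=.
  by rewrite dvdp_map.
case/dvdp_prod_XsubC => m hE; have := eqp_size hE.
rewrite size_map_poly szh size_prod_XsubC.
case: (mask m _) hE => // x s hE _; exists x.
by rewrite (eqp_root hE) root_prod_XsubC mem_head.
Qed.

Lemma quadratic_root (c0 c1 c2 : F) : c2 != 0 ->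
  exists x : L, c0%:A + c1%:A * x + c2%:A * x ^+ 2 = 0.
Proof.
move=> c20; pose h : {poly F} := 'X^2 + (c1 / c2 *: 'X + (c0 / c2)%:P).
have lt3 : (size (c1 / c2 *: 'X + (c0 / c2)%:P)%R < size ('X^2 : {poly F}))%N.
  rewrite size_polyXn ltnS (leq_trans (size_polyD _ _)) // geq_max.
  by rewrite (leq_trans (size_scale_leq _ _)) ?size_polyX // (leq_trans (size_polyC_leq1 _)).
have szh : size h = 3%N by rewrite size_polyDl // size_polyXn.
have h_mon : h \is monic by rewrite monicE lead_coefDl // lead_coefXn.
have [x hx] := irreducible_quadratic_root h_mon szh; exists x.
have E : x ^+ 2 + ((c1 / c2)%:A * x + (c0 / c2)%:A) = 0.
  move: hx; rewrite rootE !rmorphD /= map_polyXn linearZ /= map_polyX map_polyC /=.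
  by rewrite !hornerD hornerXn hornerZ hornerX hornerC => /eqP.
have c2A : c2%:A != 0 :> L by rewrite scaler_eq0 (negPf c20) oner_eq0.
have DE (c : F) : c2%:A * (c / c2)%:A = c%:A :> L.
  by rewrite -scalerAl mul1r scalerA mulrC divfK.
by rewrite -[RHS](mulr0 c2%:A) -E !mulrDr mulrA !DE; ring.
Qed.

Lemma quadratic_root_frob (c0 c1 c2 : F) (x : L) :
  c0%:A + c1%:A * x + c2%:A * x ^+ 2 = 0 ->
  c0%:A + c1%:A * fr x + c2%:A * fr x ^+ 2 = 0.
Proof.
move=> Ex; have frA (c : F) : fr c%:A = c%:A by rewrite frob_scale frob1.
have := congr1 fr Ex.
by rewrite !expr2 !(frobD cardL) !(frobM, frA) (frob0 cardL).
Qed.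

(* The conjugates of a root are roots, and there are at most two of them. *)
Lemma quadratic_root_fixed (c0 c1 c2 : F) (x : L) : c2 != 0 ->
  c0%:A + c1%:A * x + c2%:A * x ^+ 2 = 0 -> fr (fr x) = x.
Proof.
move=> c20 Ex; have c2A : c2%:A != 0 :> L by rewrite scaler_eq0 (negPf c20) oner_eq0.
have E1 := quadratic_root_frob Ex; have E2 := quadratic_root_frob E1.
have quo (y z : L) : c0%:A + c1%:A * y + c2%:A * y ^+ 2 = 0 ->
    c0%:A + c1%:A * z + c2%:A * z ^+ 2 = 0 -> y != z -> c1%:A = - (c2%:A * (y + z)).
  move=> Ey Ez; rewrite -subr_eq0 => yz; apply: (mulIf yz); apply/eqP.
  rewrite -subr_eq0; apply/eqP.
  transitivity ((c0%:A + c1%:A * y + c2%:A * y ^+ 2) - (c0%:A + c1%:A * z + c2%:A * z ^+ 2)).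
    by ring.
  by rewrite Ey Ez subrr.
have [E|nx] := eqVneq (fr x) x; first by rewrite !E.
have nfx : fr (fr x) != fr x by apply: contra_neq nx => E; apply: (frob_inj cardL).
have := quo _ _ E2 E1 nfx; rewrite (quo _ _ E1 Ex nx) => /oppr_inj/(mulfI c2A).
by rewrite [fr x + x]addrC => /addIr.
Qed.

Lemma ev_row_mul u (A : 'M[F]_4) j : (u *m emb A) 0 j = ev u (col j A)^T.
Proof. by rewrite mxE; apply: eq_bigr => i _; rewrite !mxE mulrC mulr_algl. Qed.

(** If the entry (k, l) of the form is nonzero, columns k and l are independent over F because the
    diagonal vanishes. Both are relations between the entries of [u]. *)
Lemma rk_le2_of_alt p u : p != 0 -> u *m emb (altmx p) = 0 -> (rk u <= 2)%N.
Proof.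
move=> p0 up0; have [k [l Akl]] : exists k l, altmx p k l != 0.
  have [/existsP[k /existsP[l kl]]|A0] := boolP [exists k, exists l, altmx p k l != 0].
    by exists k, l.
  case/eqP: p0; apply/rowP=> i; rewrite mxE.
  have {}A0 k l : altmx p k l = 0.
    by move/existsPn: A0 => /(_ k)/existsPn/(_ l); rewrite negbK => /eqP.
  elim/forall_inord: i => i i6.
  have := (A0 (inord 0) (inord 1), A0 (inord 0) (inord 2), A0 (inord 0) (inord 3),
           (A0 (inord 1) (inord 2), A0 (inord 1) (inord 3), A0 (inord 2) (inord 3))).
  by rewrite !altmxE //= => -[[[a b] c] [[d e] f]]; case: i i6 => [|[|[|[|[|[|]]]]]].
move: (altmx p) (altmx_diag p) (altmx_anti p) Akl up0 => A Ad Aa Akl up0.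
apply/rk_le2P => //; exists (col k A)^T, (col l A)^T.
rewrite -!ev_row_mul up0 !mxE; split=> //.
apply/free2P => s t /rowP E; have := (E k, E l).
rewrite !mxE !Ad !mulr0 addr0 add0r (Aa l) mulrN => -[/eqP + /eqP].
by rewrite oppr_eq0 !mulf_eq0 (negPf Akl) !orbF => /eqP-> /eqP->.
Qed.

(** If the Pfaffian were 0, the radical of this form over F would contain a nonzero word of the
    code, and that word would have rank at most 2. *)
Lemma mrd_anisotropic (g h : 'rV[L]_4) p : mrd <<[:: g; h]>> -> p != 0 -> ev (wedge g h) p = 0 ->
  pfaffian p != 0.
Proof.
move=> /mrdP[dimC rC] p0 ghp; apply/negP => /eqP pf0.
have [||s [t [st E]]] := @degenerate_isotropic _ (emb p) g h.
- by rewrite pfaffian_map pf0 rmorph0.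
- by rewrite -[RHS]ghp; apply: eq_bigr => i _; rewrite mxE mulr_algl.
have gh_free : free [:: g; h] by rewrite /free dimC.
have w0 : s *: g + t *: h != 0.
  by apply: contraL st => /eqP/(free2P _ _ gh_free)[-> ->]; rewrite eqxx.
have wC : s *: g + t *: h \in <<[:: g; h]>>%VS by apply/mem_span2; exists s, t.
have := rC _ wC w0; rewrite ltnNge => /negP; apply.
by rewrite altmx_map in E; apply: rk_le2_of_alt E.
Qed.

Lemma vfrob_mul u (A : 'M[F]_4) : vfrob (u *m emb A) = vfrob u *m emb A.
Proof.
apply/rowP=> j; rewrite mxE !mxE (frob_sum cardL); apply: eq_bigr => i _.
by rewrite !mxE mulrC mulr_algl frob_scale mulrC mulr_algl.
Qed.

Lemma vfrobD u v : vfrob (u + v) = vfrob u + vfrob v.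
Proof. by apply/rowP=> j; rewrite !mxE (frobD cardL). Qed.
Lemma vfrobZ k u : vfrob (k *: u) = fr k *: vfrob u.
Proof. by apply/rowP=> j; rewrite !mxE frobM. Qed.
Lemma vfrob4 u : vfrob (vfrob (vfrob (vfrob u))) = u.
Proof. by apply/rowP=> j; rewrite !mxE (frob4 cardL). Qed.
Lemma vfrob_eq0 u : (vfrob u == 0) = (u == 0).
Proof.
apply/eqP/eqP => [E|->]; last by apply/rowP=> j; rewrite !mxE (frob0 cardL).
by apply/rowP=> j; move/rowP/(_ j): E; rewrite !mxE => /eqP; rewrite (frob_eq0 cardL) => /eqP.
Qed.

(* Scaling an entry of [u] to 1 puts all entries into the field of order q^2. *)
Lemma rk_le2_of_vfrob2 u k : vfrob (vfrob u) = k *: u -> (rk u <= 2)%N.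
Proof.
move=> Eu; have [->|/rV0Pn[j uj]] := eqVneq u 0.
  rewrite /rk (_ : <<_>>%VS = 0%VS) ?dimv0 //.
  by apply/eqP; rewrite -subv0; apply/span_subvP=> _ /mapP[j _ ->]; rewrite mxE mem0v.
pose w := (u 0 j)^-1 *: u; have uw : u = u 0 j *: w by rewrite scalerA divff ?scale1r.
have Ew : vfrob (vfrob w) = w.
  have kE : fr (fr (u 0 j)) = k * u 0 j by move/rowP/(_ j): Eu; rewrite !mxE.
  rewrite /w !vfrobZ !frobV Eu scalerA kE; congr (_ *: _).
  have k0 : k != 0 by apply: contraTneq uj => k0; rewrite -(frob_eq0 cardL) -(frob_eq0 cardL) kE k0 mul0r negbK.
  by rewrite invfM mulrAC mulVf ?mul1r.
have rw : (rk w <= 2)%N.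
  rewrite -(leq_exp2l _ _ (q_gt1 cardL)) -card_vspace -limg_ev.
  apply: leq_trans (card_fixed_le cardL (isT : (0 < 2)%N)).
  apply: subset_leq_card; apply/subsetP=> _ /memv_imgP[c _ ->].
  by rewrite inE lfunE /= expnS expn1 exprM -![_ ^+ q]/(fr _) -!ev_vfrob // Ew.
clearbody w; apply/rk_le2P => //; have /rk_le2P[c [d [cd Ec Ed]]] := rw.
by exists c, d; rewrite uw !ev_scale Ec Ed !mulr0.
Qed.

Lemma mrd_exists C : mrd C ->
  exists u a b, rk u = 4%N /\ C = <<[:: u; vtwist a b u]>>%VS.
Proof.
move=> mC; have [dimC rC] := mrdP _ mC.
have [|g [h [gC hC gh_free]]] := exists_free2 (U := C); first by rewrite dimC.
have CE := span_free2 dimC gC hC gh_free; rewrite CE in mC.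
pose m := wedge g h; pose k := lker (linfun (ev m)).
have kP p : (p \in k) = (ev m p == 0) by rewrite memv_ker lfunE.
(* The six minors span at most the 4-dimensional space [L], which leaves at least two independent
   relations over F between them. *)
have dimk : (1 < \dim k)%N.
  have := rk_ev m; rewrite -/k; suff : (rk m <= 4)%N by lia.
  by apply: leq_trans (dimvS (subvf _)) _; rewrite dimL.
have [p1 [p2 [p1k p2k p_free]]] := exists_free2 dimk.
have pf_neq0 p : p \in k -> p != 0 -> pfaffian p != 0.
  by rewrite kP => /eqP pk p0; apply: mrd_anisotropic mC p0 pk.
have [p2_neq0 p1p2] : p2 != 0 /\ forall c : F, p1 - c *: p2 != 0.
  split=> [|c]; apply: contraTneq p_free => E; apply/free2P.
    by move/(_ 0 1); rewrite scale0r add0r E scaler0 => /(_ erefl)[_ /eqP]; rewrite oner_eq0.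
  by move/(_ 1 (- c)); rewrite scale1r scaleNr E => /(_ erefl)[/eqP]; rewrite oner_eq0.
have c20 := pf_neq0 _ p2k p2_neq0; pose B := polar p1 p2.
have pfE (x : L) : pfaffian (emb p1 - x *: emb p2) =
    (pfaffian p1)%:A + (- B)%:A * x + (pfaffian p2)%:A * x ^+ 2.
  rewrite pfaffianB !pfaffian_map; have -> : polar (emb p1) (emb p2) = B%:A.
    by rewrite /B /polar !mxE -!in_algE !(rmorphD, rmorphN, rmorphM).
  by rewrite scaleNr /=; ring.
have [x xE] := quadratic_root (pfaffian p1) (- B) c20.
have fxE := quadratic_root_frob xE; have ffx := quadratic_root_fixed c20 xE.
(* A root c in F would make p1 - c p2 a nonzero degenerate form over F that vanishes on the code. *)
have nfx : fr x != x.
  apply/eqP => /(frob_fixed)[c cE].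
  have := pf_neq0 (p1 - c *: p2); rewrite p1p2 rpredB ?rpredZ // => /(_ isT isT)/negP; apply.
  rewrite -(inj_eq (fmorph_inj (in_alg L))) -pfaffian_map rmorph0 /= map_mxB map_mxZ /=.
  by rewrite -cE pfE xE.
pose A1 := emb (altmx p1); pose A2 := emb (altmx p2).
have A2_inj w : w *m A2 = 0 -> w = 0.
  rewrite /A2 -altmx_map; apply: altmx_inj.
  by rewrite pfaffian_map fmorph_eq0.
(* This says that [w] is in the radical of p1 - y p2. Since A2 is invertible, it is an eigenvector
   condition, so the radicals for [x] and [fr x] meet only in 0. Both forms are over F, so Frobenius
   maps the first radical into the second. *)
pose eig y w := w *m A1 = y *: (w *m A2).
have isotropic y : (pfaffian p1)%:A + (- B)%:A * y + (pfaffian p2)%:A * y ^+ 2 = 0 ->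
    exists w, [/\ w \in C, w != 0 & eig y w].
  rewrite -pfE => pf0.
  have [|s [t [st E]]] := @degenerate_isotropic _ _ g h pf0.
    transitivity (ev m p1 - y * ev m p2).
      rewrite /ev mulr_sumr -sumrB; apply: eq_bigr => i _.
      by rewrite -/m !mxE mulrBl -mulrA !mulr_algl.
    by move: p1k p2k; rewrite !kP => /eqP-> /eqP->; rewrite mulr0 subrr.
  exists (s *: g + t *: h); split.
  - by rewrite CE; apply/mem_span2; exists s, t.
  - by apply: contraL st => /eqP/(free2P _ _ gh_free)[-> ->]; rewrite eqxx.
  - move: E; rewrite altmxB !altmx_map mulmxBr -scalemxAr => /eqP.
    by rewrite subr_eq0 => /eqP.
have eig_frob y w : eig y w -> eig (fr y) (vfrob w).
  by rewrite /eig /A1 /A2 -!vfrob_mul => ->; rewrite vfrobZ.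
have eig_lin y w1 w2 a1 a2 : eig y w1 -> eig y w2 -> eig y (a1 *: w1 + a2 *: w2).
  rewrite /eig => E1 E2; rewrite !mulmxDl -!scalemxAl E1 E2 scalerDr !scalerA.
  by rewrite ![y * _]mulrC.
have eig_sum0 w1 w2 : eig x w1 -> eig (fr x) w2 -> eig (fr x) (w1 + w2) -> w1 = 0.
  rewrite /eig => E1 E2 /eqP; rewrite !mulmxDl E1 E2 scalerDr (inj_eq (addIr _)).
  rewrite -subr_eq0 -scalerBl scaler_eq0 subr_eq0 eq_sym (negPf nfx) /= => /eqP.
  exact: A2_inj.
have [u [uC u0 Eu]] := isotropic _ xE; have [v [vC v0 Ev]] := isotropic _ fxE.
pose u1 := vfrob u; pose u2 := vfrob u1; pose u3 := vfrob u2.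
have Eu1 : eig (fr x) u1 by apply: eig_frob.
have Eu2 : eig x u2 by rewrite -ffx; apply: eig_frob.
have Eu3 : eig (fr x) u3 by apply: eig_frob.
have u02 : free [:: u; u2].
  rewrite free2 u0; apply/negP => /vlineP[c cE].
  by have := rC u uC u0; rewrite ltnNge (rk_le2_of_vfrob2 cE).
have u13 : free [:: u1; u3].
  apply/free2P => s t E.
  have : vfrob (vfrob (vfrob (s *: u1 + t *: u3))) == 0 by rewrite !vfrob_eq0 E.
  rewrite !(vfrobD, vfrobZ) !vfrob4 -/u1 -/u2 => /eqP/(free2P _ _ u02)[/eqP + /eqP].
  by rewrite !(frob_eq0 cardL) => /eqP-> /eqP->.
pose M := \matrix_(i < 4) [:: u; u1; u2; u3]`_i.
have kM a : a *m M = (a 0 (inord 0) *: u + a 0 (inord 2) *: u2)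
    + (a 0 (inord 1) *: u1 + a 0 (inord 3) *: u3).
  rewrite mulmx_sum_row sum_inord /index_iota /= !big_cons big_nil !rowK !inordK //=.
  by rewrite addr0 addrACA !addrA.
have eig_zero y : eig y 0 by rewrite /eig !mul0mx scaler0.
(* The conjugates form a basis of the whole space: [u], [u2] are independent in one radical and
   [u1], [u3] in the other. *)
have M_unit : M \in unitmx.
  rewrite -row_free_unit -kermx_eq0; apply/eqP/eqP/rowV0P => a /sub_kermxP.
  rewrite kM => E; have w0 := eig_sum0 _ _ (eig_lin _ _ _ _ _ Eu Eu2) (eig_lin _ _ _ _ _ Eu1 Eu3).
  move: (w0 (a 0 (inord 0)) (a 0 (inord 2)) (a 0 (inord 1)) (a 0 (inord 3))).
  rewrite E => /(_ (eig_zero _)) {}w0; move: E; rewrite w0 add0r.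
  case/(free2P _ _ u13) => a1 a3; case/(free2P _ _ u02): w0 => a0 a2.
  by apply/rowP; elim/forall_inord => -[|[|[|[|]]]] // _; rewrite [RHS]mxE.
(* A relation over F between the entries of [u] also holds for its conjugates, hence for every
   vector, in particular for the unit vectors. *)
have ru : rk u = 4%N.
  apply/eqP/rk4P => // c uc; apply/rowP=> j; rewrite mxE.
  have : ev (delta_mx 0 j *m invmx M *m M) c = 0.
    rewrite kM !(ev_add, ev_scale) /u3 /u2 /u1 !(ev_vfrob dimL) uc.
    by rewrite !(frob0 cardL) !mulr0 !addr0.
  rewrite mulmxKV // /ev (bigD1 j) //= big1 => [|i ij]; last first.
    by rewrite mxE (negPf ij) andbF scaler0.
  rewrite mxE !eqxx addr0 => /eqP.
  by rewrite scaler_eq0 oner_eq0 orbF => /eqP.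
(* As [v] is in the radical for [fr x], its components along [u] and [u2] add up to 0; the other two
   exhibit it as a twist of [u]. *)
have [a vE] : exists a, v = a *m M by exists (v *m invmx M); rewrite mulmxKV.
rewrite kM in vE.
have w0 := eig_sum0 _ _ (eig_lin _ _ _ _ _ Eu Eu2) (eig_lin _ _ _ _ _ Eu1 Eu3).
have Ev' := Ev; rewrite vE in Ev'; have {}w0 := w0 _ _ _ _ Ev'; rewrite w0 add0r in vE.
exists u, (a 0 (inord 1)), (a 0 (inord 3)); split=> //.
rewrite /vtwist -vE; apply: span_free2 => //.
rewrite free2 u0; apply/negP => /vlineP[c cE].
case/eqP: v0; apply: (eig_sum0 v 0) => //; last by rewrite addr0.
by rewrite cE -[c *: u]addr0 -(scaler0 _ 0); apply: eig_lin.
Qed.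
End Existence.

(** * Counting *)

Section CountSubspaces.
Variables (K : finFieldType) (n : nat).
Local Notation V := 'rV[K]_n.
Local Notation Q := #|K|.

Definition free_pairs (U : {vspace V}) :=
  [set p : V * V | [&& p.1 \in U, p.2 \in U & free [:: p.1; p.2]]].

Lemma card_free_pairs (U : {vspace V}) :
  #|free_pairs U| = ((Q ^ \dim U - 1) * (Q ^ \dim U - Q))%N.
Proof.
rewrite (card_fibres_eq (B := [set x in U | x != 0]) (f := fst) (k := (Q ^ \dim U - Q)%N)).
- congr (_ * _)%N; rewrite -card_vspace (cardD1 (0 : V) (mem U)) mem0v add1n subn1.
  by apply: eq_card => x; rewrite !inE andbC.
- by move=> p; rewrite !inE free2 => /and4P[-> _ ->].
move=> x; rewrite inE => /andP[xU x0].
have cL : #|(<[x]>%VS : {vspace V})| = Q by rewrite card_vspace dim_vline x0 expn1.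
have cI : #|[predI (U : {pred V}) & <[x]>%VS]| = Q.
  rewrite -cL; apply: eq_card => y; rewrite !inE andb_idl // => /vlineP[k ->].
  exact: memvZ.
rewrite -card_vspace -(cardID (<[x]>%VS : {pred V}) U) cI addKn.
rewrite -[RHS](card_imset _ (f := fun y => (x, y))); last by move=> y z [].
apply: eq_card => -[x' y]; rewrite !inE /= free2; apply/idP/imsetP.
  by case/andP=> /and4P[_ yU _ nyx] /eqP xE; rewrite xE in nyx *; exists y; rewrite // inE yU nyx.
by case=> z; rewrite !inE => /andP[nz zU] [-> ->]; rewrite xU zU x0 nz eqxx.
Qed.

(** Ordered pairs of independent vectors, sorted by the plane they span. *)
Lemma card_gauss_binom2 : ((Q ^ n - 1) * (Q ^ n - Q) =
  gauss_binom K n 2 * ((Q ^ 2 - 1) * (Q ^ 2 - Q)))%N.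
Proof.
have dimV : \dim {: V} = n by rewrite dimvf /dim /= mul1n.
rewrite -[X in (Q ^ X - 1)%N]dimV -[X in (_ * (Q ^ X - Q))%N]dimV -card_free_pairs.
apply: (card_fibres_eq (f := fun p : V * V => <<[:: p.1; p.2]>>%VS)).
  by move=> p; rewrite !inE !memvf /= => /eqnP->.
move=> C; rewrite inE => /eqP dimC; rewrite -{1 2}dimC -card_free_pairs.
apply: eq_card => -[x y]; rewrite !inE !memvf /=; apply/andP/and3P.
  case=> xy /eqP<-; split=> //.
    by apply: memv_span; rewrite mem_head.
  by apply: memv_span; rewrite !inE eqxx orbT.
by case=> xC yC xy; split=> //; rewrite eq_sym (span_free2 dimC xC yC).
Qed.
End CountSubspaces.

Section CountCodes.
Variables (F : finFieldType) (L0 : fieldExtType F).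
Hypothesis dimL : \dim {: L0} = 4%N.
Local Notation L := (finvect_type L0).
Local Notation q := #|F|.
Local Notation fr := (@frob L q).
Local Notation emb := (map_mx (in_alg L)).
Implicit Types (u v w : 'rV[L]_4) (c d : 'rV[F]_4).

Let cardL := cardL dimL.

Definition twist_data : finType := ('rV[L]_4 * (L * L))%type.
Implicit Types t : twist_data.
Definition tw t := vtwist t.2.1 t.2.2 t.1.
Definition code t : {vspace 'rV[L]_4} := <<[:: t.1; tw t]>>.
Definition good t := (rk t.1 == 4%N) && (norm q t.2.1 != norm q t.2.2).
(** The generators u, v of the code become k u, l v. Dividing by the conjugates of k compensates for
    its appearance in the conjugates of k u. *)
Definition rescale (k l : L) t : twist_data :=
  (k *: t.1, (l * t.2.1 / fr k, l * t.2.2 / fr (fr (fr k)))).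
(** Takes v as the new u. The new coefficients cancel the u^(q^2) terms of v^q and v^(q^3), which
    leaves a multiple of the old u. *)
Definition swap t : twist_data := (tw t, (fr (fr (fr t.2.2)), - fr t.2.1)).

Lemma tw_rescale k l t : k != 0 -> tw (rescale k l t) = l *: tw t.
Proof.
move=> k0; rewrite /tw /vtwist /= !(vfrobZ, scalerA, scalerDr).
by rewrite !divfK ?(frob_eq0 cardL).
Qed.

Lemma tw_swap t : tw (swap t) =
  (fr t.2.2 * fr (fr (fr t.2.2)) - fr t.2.1 * fr (fr (fr t.2.1))) *: t.1.
Proof.
rewrite {1}/tw /swap /= {1}/vtwist /tw /vtwist.
rewrite !(vfrobD dimL, vfrobZ, vfrob4 dimL, frob4 cardL).
by apply/rowP=> j; rewrite !mxE; ring.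
Qed.

Lemma swap_coef_neq0 t : good t ->
  fr t.2.2 * fr (fr (fr t.2.2)) - fr t.2.1 * fr (fr (fr t.2.1)) != 0.
Proof.
case/andP=> _; apply: contraNneq => /eqP; rewrite subr_eq0 => /eqP E.
by apply/eqP/(norm_eq_of_half cardL).
Qed.

Lemma good_rescale k l t : k != 0 -> l != 0 -> good t -> good (rescale k l t).
Proof.
move=> k0 l0 /andP[/rk4P ru Nab]; apply/andP; split=> /=.
  apply/rk4P => c; rewrite ev_scale => /eqP.
  by rewrite mulf_eq0 (negPf k0) => /eqP/ru.
rewrite !normM !normV !(norm_frob cardL).
apply: contraNneq Nab => /mulIf E; apply/eqP.
have Nk : (norm q k)^-1 != 0 by rewrite invr_eq0 (norm_eq0 cardL).
have Nl : norm q l != 0 by rewrite (norm_eq0 cardL).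
by apply: (mulfI Nl); apply: E.
Qed.

Lemma good_swap t : good t -> good (swap t).
Proof.
move=> gt; have e0 := swap_coef_neq0 gt; case/andP: (gt) => /rk4P ru Nab.
apply/andP; split=> /=.
  apply/rk4P => c vc; apply: ru; apply: (mulfI e0).
  rewrite -ev_scale -tw_swap /tw /swap /= (ev_vtwist dimL) vc /twist !(frob0 cardL); ring.
by rewrite (normN cardL) !(norm_frob cardL) eq_sym.
Qed.

Lemma code_rescale k l t : k != 0 -> l != 0 -> code (rescale k l t) = code t.
Proof.
move=> k0 l0; rewrite /code tw_rescale //=.
exact: span2_scale.
Qed.

Lemma code_swap t : good t -> code (swap t) = code t.
Proof.
move=> /swap_coef_neq0 e0; rewrite /code tw_swap /= -[tw t]scale1r.
rewrite span2_scale ?oner_neq0 //; apply: eq_span => z.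
by rewrite !inE scale1r orbC.
Qed.

Lemma rk4_neq0 u : rk u = 4%N -> u != 0.
Proof.
move=> ru; apply/eqP => u0; have [|/eqP] := conjugates_free dimL (a0 := 1) (a1 := 0) (a2 := 0) (a3 := 0) ru.
  by rewrite u0 !scale0r scaler0 !addr0.
by rewrite oner_eq0.
Qed.

Lemma norm_neq_coef0 (a b l : L) : norm q a != norm q b -> l * a = 0 -> l * b = 0 -> l = 0.
Proof.
move=> Nab /eqP la /eqP lb; apply/eqP; apply: contraNT Nab => l0.
by move: la lb; rewrite !mulf_eq0 (negPf l0) => /eqP-> /eqP->.
Qed.

(** The new second generator is s u0 + r v0 for some s and r. Comparing coefficients along the
    independent conjugates of u0 gives s = 0 and determines a and b from r and k. *)
Lemma fibre_line t0 t k : good t0 -> good t -> code t = code t0 -> t.1 = k *: t0.1 ->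
  exists2 l, l != 0 & t = rescale k l t0.
Proof.
case: t0 t => [u0 [a0 b0]] [u [a b]] /andP[/eqP ru0 N0] /andP[/eqP ru N] /= E uE.
rewrite /= in ru0 N0 ru N.
have k0 : k != 0.
  by apply: contraTneq (rk4_neq0 ru) => k0; rewrite uE k0 scale0r eqxx.
have : vtwist a b u \in code (u0, (a0, b0)).
  by rewrite -E; apply/mem_span2; exists 0, 1; rewrite scale0r add0r scale1r.
case/mem_span2=> s [r]; rewrite /tw /= uE /vtwist !vfrobZ => vE.
have [|_ Ea _ Eb] := conjugates_free dimL (a0 := - s) (a1 := a * fr k - r * a0)
    (a2 := 0) (a3 := b * fr (fr (fr k)) - r * b0) ru0.
  apply/rowP=> j; move/rowP/(_ j): vE; rewrite !mxE => vE.
  by rewrite mul0r addr0; move/eqP: vE; rewrite -subr_eq0 => /eqP <-; ring.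
have aE : r * a0 = a * fr k by apply/eqP; rewrite eq_sym -subr_eq0 Ea.
have bE : r * b0 = b * fr (fr (fr k)) by apply/eqP; rewrite eq_sym -subr_eq0 Eb.
exists r.
  apply: contraNneq N => r0; move: aE bE; rewrite r0 !mul0r => /esym/eqP + /esym/eqP.
  by rewrite !mulf_eq0 !(frob_eq0 cardL) (negPf k0) !orbF => /eqP-> /eqP->.
by rewrite /rescale /= aE bE !mulfK ?(frob_eq0 cardL).
Qed.

(** Let u = k u0 + m v0 with k and m nonzero. A twist of u lying in the code has no component along
    the conjugate u0^(q^2), and comparing the components along u0^q and u0^(q^3) turns this into the
    relation of [norm_eq_of_cross] for x = m / k, so that N(a0) = N(b0). *)
Lemma fibre_cases t0 t : good t0 -> good t -> code t = code t0 ->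
  exists k, t.1 = k *: t0.1 \/ t.1 = k *: tw t0.
Proof.
case: t0 t => [u0 [a0 b0]] [u [a b]] /andP[/eqP ru0 N0] /andP[/eqP ru N] /= E.
rewrite /= in ru0 N0 ru N.
have : u \in code (u0, (a0, b0)).
  by rewrite -E; apply/mem_span2; exists 1, 0; rewrite scale0r addr0 scale1r.
case/mem_span2=> k [m]; rewrite /tw /= => uE.
have [m0|m0] := eqVneq m 0; first by exists k; left; rewrite uE m0 scale0r addr0.
have [k0|k0] := eqVneq k 0; first by exists m; right; rewrite uE k0 scale0r add0r.
have : vtwist a b u \in code (u0, (a0, b0)).
  by rewrite -E; apply/mem_span2; exists 0, 1; rewrite scale0r add0r scale1r.
case/mem_span2=> s [r]; rewrite /tw /= uE /vtwist.
rewrite !(vfrobD dimL, vfrobZ, vfrob4 dimL) => vE.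
have [|_ Ea Ec Eb] := conjugates_free dimL
    (a0 := a * fr m * fr b0 + b * fr (fr (fr m)) * fr (fr (fr a0)) - s)
    (a1 := a * fr k - r * a0)
    (a2 := a * fr m * fr a0 + b * fr (fr (fr m)) * fr (fr (fr b0)))
    (a3 := b * fr (fr (fr k)) - r * b0) ru0.
  apply/rowP=> j; move/rowP/(_ j): vE; rewrite !mxE => vE.
  by move/eqP: vE; rewrite -subr_eq0 => /eqP <-; ring.
have fk0 : fr k != 0 by rewrite (frob_eq0 cardL).
have fffk0 : fr (fr (fr k)) != 0 by rewrite !(frob_eq0 cardL).
have aE : r * a0 = a * fr k by apply/eqP; rewrite eq_sym -subr_eq0 Ea.
have bE : r * b0 = b * fr (fr (fr k)) by apply/eqP; rewrite eq_sym -subr_eq0 Eb.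
have r0 : r != 0.
  apply: contraNneq N => r0; move: aE bE; rewrite r0 !mul0r => /esym/eqP + /esym/eqP.
  by rewrite !mulf_eq0 (negPf fk0) (negPf fffk0) !orbF => /eqP-> /eqP->.
case/eqP: N0; apply: (norm_eq_of_cross cardL (x := m / k)).
  by rewrite mulf_neq0 ?invr_eq0.
apply: (mulfI r0); rewrite mulr0 mulrDr !mulrA aE bE !frobM !frobV -[RHS]Ec.
by field; rewrite fk0 fffk0.
Qed.

Lemma rescale_inj t k k' l l' : good t -> rescale k l t = rescale k' l' t ->
  k != 0 -> k = k' /\ l = l'.
Proof.
case/andP=> /eqP/rk4_neq0 u0 Nab [kE Ea Eb] k0.
have kk : k = k'.
  move/eqP: kE; rewrite -subr_eq0 -scalerBl scaler_eq0 (negPf u0) orbF subr_eq0.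
  by move/eqP.
have fk0 : fr k != 0 by rewrite (frob_eq0 cardL).
have fffk0 : fr (fr (fr k)) != 0 by rewrite !(frob_eq0 cardL).
rewrite -kk in Ea Eb; split=> //.
have {}Ea := mulIf (invr_neq0 fk0) Ea; have {}Eb := mulIf (invr_neq0 fffk0) Eb.
apply/eqP; rewrite -subr_eq0; apply/eqP/(norm_neq_coef0 Nab).
  by rewrite mulrBl Ea subrr.
by rewrite mulrBl Eb subrr.
Qed.

Lemma rescale_swap_neq t k k' l l' : good t -> k' != 0 -> rescale k l t <> rescale k' l' (swap t).
Proof.
case/andP=> /eqP ru Nab k0 [E _ _].
have [|_ Ea _ Eb] := conjugates_free dimL (a0 := - k) (a1 := k' * t.2.1)
    (a2 := 0) (a3 := k' * t.2.2) ru.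
  by rewrite scaleNr E /tw /vtwist scalerDr !scalerA scale0r addr0 -addrA addNr.
by move: k0; rewrite (norm_neq_coef0 Nab Ea Eb) eqxx.
Qed.

(** Pairs (k, l) of nonzero scalars act freely by [rescale], and the fibre consists of two disjoint
    orbits, those of [t0] and of [swap t0]. *)
Lemma card_fibre C : mrd C -> #|[set t in [set t | good t] | code t == C]|
  = (2 * ((q ^ 4 - 1) * (q ^ 4 - 1)))%N.
Proof.
move=> mC; have [u [a [b [ru CE]]]] := mrd_exists dimL mC.
pose t0 : twist_data := (u, (a, b)).
have g0 : good t0.
  by apply/andP; split; [apply/eqP | apply: (norm_neq_of_mrd dimL ru); rewrite -CE].
have g1 := good_swap g0; pose A := [set~ (0 : L)].
pose base (s : bool) := if s then t0 else swap t0.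
have gb s : good (base s) by case: s.
have cb s : code (base s) = C by case: s; rewrite /= ?code_swap // CE.
pose f (x : bool * (L * L)) := rescale x.2.1 x.2.2 (base x.1).
have cD : #|setX [set: bool] (setX A A)| = (2 * ((q ^ 4 - 1) * (q ^ 4 - 1)))%N.
  by rewrite !cardsX cardsT card_bool cardsC1 cardL subn1.
rewrite -cD -(card_in_imset (f := f)); last first.
  move=> [s [k l]] [s' [k' l']]; rewrite !inE /= => /andP[k0 _] /andP[k'0 _].
  case: s s' => [] [] /=; rewrite /f /=.
  - by move=> /(rescale_inj g0)/(_ k0)[-> ->].
  - by move=> /(rescale_swap_neq g0 k'0).
  - by move=> /esym/(rescale_swap_neq g0 k0).
  - by move=> /(rescale_inj g1)/(_ k0)[-> ->].
apply: eq_card => t; rewrite !inE; apply/andP/imsetP => [[gt /eqP ct]|]; last first.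
  case=> -[s [k l]]; rewrite !inE /= => /andP[k0 l0] ->.
  by rewrite good_rescale // code_rescale // cb.
suff [s [k tk]] : exists s k, t.1 = k *: (base s).1.
  have [|l l0 tE] := fibre_line (gb s) gt _ tk; first by rewrite ct cb.
  exists (s, (k, l)) => //; rewrite !inE /= l0 andbT.
  apply: contraTneq gt => k0; rewrite /good tk k0 scale0r.
  by apply/nandP; left; apply/negP => /eqP/rk4_neq0; rewrite eqxx.
have [|k [tk|tk]] := fibre_cases g0 gt; first by rewrite ct -(cb true).
  by exists true, k.
by exists false, k.
Qed.

Lemma exists_rk4 : exists u : 'rV[L]_4, rk u = 4%N.
Proof.
pose X := tcast dimL (vbasis {: L0}); have Xfree : free X.
  by rewrite /X val_tcast; apply: basis_free (vbasisP _).
exists (\row_j X`_j); apply/eqP/rk4P => c uc; apply/rowP=> j; rewrite mxE.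
have /freeP h := Xfree; apply: (h (fun j => c 0 j)); rewrite -[RHS]uc.
by apply: eq_bigr => i _; rewrite mxE.
Qed.

(** Once one vector u of rank 4 is fixed, A |-> u A is a bijection from GL_4(F) onto the vectors of
    rank 4. *)
Lemma card_rk4 : #|[set u : 'rV[L]_4 | rk u == 4%N]|
  = (q ^ 6 * ((q - 1) * (q ^ 2 - 1) * (q ^ 3 - 1) * (q ^ 4 - 1)))%N.
Proof.
have -> : (q ^ 6 * ((q - 1) * (q ^ 2 - 1) * (q ^ 3 - 1) * (q ^ 4 - 1)))%N = #|'GL_4[F]%g|.
  by rewrite card_GL // (_ : 'C(4, 2) = 6%N) // /index_iota /= !big_cons big_nil muln1 expn1 !mulnA.
have -> : #|'GL_4[F]%g| = #|[set A : 'M[F]_4 | A \in unitmx]|.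
  by rewrite cardsT card_sub; apply: eq_card => A; rewrite inE [RHS]inE.
have [u ru] := exists_rk4; have su := ev_surj dimL ru; have /eqP/rk4P iu := ru.
pose f (A : 'M[F]_4) := u *m emb A.
have evf A c : ev (f A) c = ev u (A *m c^T)^T.
  rewrite {1}/ev; under eq_bigr => j _ do rewrite ev_row_mul -linearZ.
  rewrite -raddf_sum; congr (ev u _); apply/rowP=> i; rewrite summxE !mxE.
  by apply: eq_bigr => j _; rewrite !mxE mulrC.
have f_inj : injective f.
  move=> A B /rowP E; apply/matrixP=> i j; have := E j.
  rewrite !ev_row_mul => /eqP; rewrite -subr_eq0 -raddfB => /eqP/iu/rowP/(_ i).
  by rewrite !mxE => /eqP; rewrite subr_eq0 => /eqP.
rewrite -(card_imset _ f_inj); apply: eq_card => w; rewrite inE; apply/rk4P/imsetP; last first.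
  case=> A; rewrite inE => A_unit -> c; rewrite evf => /iu/(congr1 trmx).
  rewrite trmxK trmx0 => Ac; apply: trmx_inj; rewrite trmx0.
  by rewrite -[c^T](mulKmx A_unit) Ac mulmx0.
move=> iw; have [g gE] := fin_all_exists (fun j => su (w 0 j)).
pose A := \matrix_(i, j) g j 0 i; have wE : w = f A.
  apply/rowP=> j; rewrite ev_row_mul -[LHS]gE; congr (ev u _).
  by apply/rowP=> i; rewrite !mxE.
exists A => //; rewrite inE -unitmx_tr -row_free_unit -kermx_eq0; apply/eqP/eqP/rowV0P => c /sub_kermxP cA.
apply: iw; rewrite wE evf.
by rewrite (_ : A *m c^T = 0) ?trmx0 ?raddf0 //; apply: trmx_inj; rewrite trmx_mul trmxK cA trmx0.
Qed.

Lemma card_mrd :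
  (#|[set C : {vspace 'rV[L]_4} | mrd C]| * (2 * ((q ^ 4 - 1) * (q ^ 4 - 1))) =
  q ^ 6 * ((q - 1) * (q ^ 2 - 1) * (q ^ 3 - 1) * (q ^ 4 - 1)) *
  #|[set p : L * L | norm q p.1 != norm q p.2]|)%N.
Proof.
rewrite -(card_fibres_eq (A := [set t | good t]) (f := code)).
- rewrite -card_rk4 -cardsX; apply: eq_card => t; rewrite !inE //.
- move=> t; rewrite !inE => /andP[/eqP ru Nab]; exact: mrd_vtwist.
- by move=> C; rewrite inE; apply: card_fibre.
Qed.
End CountCodes.

(* The density as a rational function of q, and its limit *)
From mathcomp Require Import boolp classical_sets filter reals topology normedtype derive.
Import Order.TTheory Num.Theory numFieldNormedType.Exports.
Local Open Scope classical_set_scope.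

Definition mrd_density (R : fieldType) (x : R) : R :=
  2^-1 * ((x ^+ 7 * (x ^+ 3 - 1) * (x ^+ 2 - 1) * (x - 1)
             * (x ^+ 3 - x ^+ 2 - x - 1) * (x ^+ 8 - 1) * (x ^+ 4 - 1))
           / ((x ^+ 16 - 1) * (x ^+ 12 - 1))).

Lemma rk_density_mrd (R : realType) (F : finFieldType) (L0 : fieldExtType F) :
  \dim {: L0} = 4%N -> rk_density R L0 4 2 3 = mrd_density (#|F|%:R : R).
Proof.
move=> dimL; rewrite /rk_density /gauss_binom; set q := #|F|; set x : R := q%:R.
have := card_mrd dimL; have := card_norm_neq (cardL dimL).
have := card_gauss_binom2 (finvect_type L0) 4; rewrite (cardL dimL) -/q.
rewrite /mrd /gauss_binom; set N2 := #|_|; set T := #|_|; set M := #|_|.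
have q1 : (1 < q)%N := finNzRing_gt1 F; have q0 := ltnW q1.
have x1 : 1 < x by rewrite ltr1n.
have xB k : (0 < k)%N -> (q ^ k - 1)%:R = x ^+ k - 1 :> R.
  by move=> k0; rewrite natrB ?expn_gt0 ?q0 // natrX.
have xB0 k : (0 < k)%N -> x ^+ k - 1 != 0.
  by move=> k0; rewrite subr_eq0 gt_eqF // exprn_egt1 // -lt0n.
have x0 : x != 0 by rewrite gt_eqF // (lt_trans ltr01).
have q4 : (q ^ 4 * 1 <= q ^ 4 * q ^ 12)%N by rewrite leq_mul2l expn_gt0 q0 orbT.
have q8 : (q ^ 4 * 1 <= q ^ 4 * q ^ 4)%N by rewrite leq_mul2l expn_gt0 q0 orbT.
have -> : ((q ^ 4) ^ 4 - q ^ 4 = q ^ 4 * (q ^ 12 - 1))%N.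
  by rewrite mulnBr -expnD muln1 -expnM.
have -> : ((q ^ 4) ^ 2 - q ^ 4 = q ^ 4 * (q ^ 4 - 1))%N.
  by rewrite mulnBr -expnD muln1 -expnM.
rewrite -!expnM => /(congr1 (fun n => n%:R : R)) + /(congr1 (fun n => n%:R : R))
  + /(congr1 (fun n => n%:R : R)).
rewrite !(natrM, natrD, xB, natrX) // -/x => EN ET EM.
(* Here Q^2 - 1 = (Q - 1)(Q + 1), and Q + 1 - (1 + q + q^2 + q^3) = q (q^3 - q^2 - q - 1). *)
have {}ET : T%:R = (x ^+ 4 - 1) * x * (x ^+ 3 - x ^+ 2 - x - 1).
  transitivity (T%:R + (x ^+ 4 - 1) * (1 + x + x ^+ 2 + x ^+ 3) + 1 - 1
                - (x ^+ 4 - 1) * (1 + x + x ^+ 2 + x ^+ 3)); first by ring.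
  by rewrite ET; ring.
have a1 : (q - 1)%:R = x - 1 :> R by rewrite natrB.
have e0 : 2 * ((x ^+ 4 - 1) * (x ^+ 4 - 1)) != 0 :> R.
  by rewrite !mulf_neq0 ?xB0 // pnatr_eq0.
have {}EM := canRL (mulfK e0) EM.
have d0 : (x ^+ 8 - 1) * (x ^+ 4 * (x ^+ 4 - 1)) != 0.
  by rewrite !mulf_neq0 ?xB0 // expf_neq0.
have {}EN := canRL (mulfK d0) (esym EN).
rewrite EM EN ET a1 /mrd_density.
have := (xB0 4%N isT, xB0 8%N isT, xB0 12%N isT, xB0 16%N isT).
set a4 := x ^+ 4 - 1; set a8 := x ^+ 8 - 1; set a12 := _ - 1; set a16 := x ^+ 16 - 1.
case=> -[[n4 n8] n12] n16; clearbody a4 a8 a12 a16.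
by field; rewrite n4 n8 n12 n16 x0.
Qed.

(** Numerator and denominator both have degree 28. Dividing them by x^28 gives polynomials [N] and
    [D] in 1/x with constant term 1, and 1/x tends to 0. *)
Lemma cvg_mrd_density (R : realType) :
  mrd_density (n%:R : R) @[n --> \oo] --> (2^-1 : R).
Proof.
pose N : {poly R} := (1 - 'X^3) * (1 - 'X^2) * (1 - 'X) * (1 - 'X - 'X^2 - 'X^3)
  * (1 - 'X^8) * (1 - 'X^4).
pose D : {poly R} := (1 - 'X^16) * (1 - 'X^12).
have cvg_inv : (n%:R^-1 : R) @[n --> \oo] --> (0 : R).
  apply/gtr0_cvgV0; last exact: cvgr_idn.
  by exists 1%N => // n /=; rewrite ltr0n.
have D0 : D.[0] = 1 by rewrite /D !hornerE !expr0n /=; ring.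
have N0 : N.[0] = 1 by rewrite /N !hornerE !expr0n /=; ring.
have cvg_horner (p : {poly R}) : p.[n%:R^-1] @[n --> \oo] --> p.[0].
  exact: (cvg_comp _ _ cvg_inv (@continuous_horner _ p 0)).
have cvgh : 2^-1 * (N.[n%:R^-1] / D.[n%:R^-1]) @[n --> \oo] --> 2^-1 * (N.[0] / D.[0]).
  apply: cvgM; first exact: cvg_cst.
  by apply: cvgM => //; apply: cvgV => //; rewrite D0 oner_neq0.
rewrite N0 D0 divr1 mulr1 in cvgh.
apply: cvg_trans cvgh; apply: near_eq_cvg; near=> n.
have n1 : (1 < n)%N by near: n; exists 2%N.
have x1 : 1 < n%:R :> R by rewrite ltr1n.
move: (n%:R) x1 => x x1.
have x0 : x != 0 by rewrite gt_eqF // (lt_trans ltr01).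
have xB0 k : (0 < k)%N -> x ^+ k - 1 != 0.
  by move=> k0; rewrite subr_eq0 gt_eqF // exprn_egt1 // -lt0n.
have NE : N.[x^-1] = (x ^+ 3 - 1) * (x ^+ 2 - 1) * (x - 1) * (x ^+ 3 - x ^+ 2 - x - 1)
    * (x ^+ 8 - 1) * (x ^+ 4 - 1) / x ^+ 21.
  by rewrite /N !hornerE; field.
have DE : D.[x^-1] = (x ^+ 16 - 1) * (x ^+ 12 - 1) / x ^+ 28.
  by rewrite /D !hornerE; field.
rewrite NE DE /mrd_density.
have := (xB0 12%N isT, xB0 16%N isT).
set a12 := x ^+ 12 - 1; set a16 := x ^+ 16 - 1.
case=> n12 n16; clearbody a12 a16.
by field; rewrite n12 n16 x0.
Unshelve. all: by end_near.
Qed.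

Theorem corollary4p7 (R : realType)
    (Fq : nat -> finFieldType) (Fq4 : forall q : nat, fieldExtType (Fq q))
    (hF : forall q : nat, prime_power q ->
      #|Fq q| = q /\ \dim {: Fq4 q} = 4%N) :
  (forall q : nat, prime_power q -> (2 < q)%N ->
     rk_density R (Fq4 q) 4 2 3 =
       let x : R := q%:R in
       2^-1 * ((x ^+ 7 * (x ^+ 3 - 1) * (x ^+ 2 - 1) * (x - 1)
                 * (x ^+ 3 - x ^+ 2 - x - 1) * (x ^+ 8 - 1) * (x ^+ 4 - 1))
               / ((x ^+ 16 - 1) * (x ^+ 12 - 1)))) /\
  (fun q : nat => rk_density R (Fq4 q) 4 2 3)
    @ within prime_power \oo --> (2^-1 : R).
Proof.
have densityE q : prime_power q -> rk_density R (Fq4 q) 4 2 3 = mrd_density (q%:R : R).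
  by move=> /hF[cF dimL]; rewrite rk_density_mrd // cF.
split=> [q q_pp _|]; first exact: densityE.
have cvg_pp := @cvg_within_filter _ _ _ _ eventually_filter _ prime_power (@cvg_mrd_density R).
apply: cvg_trans cvg_pp.
by apply: near_eq_cvg; rewrite near_withinE; apply: nearW => q /densityE->.
Qed.
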